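(* Let $k\ge3$ and let $1\le n_1\le\cdots\le n_k$ be integers. Then $\sigma_3(\mathbf{P}^{n_1}\times\cdots\times\mathbf{P}^{n_k})$ is non-defective, with exactly the following exceptions (in which it is defective): (a) $(n_1,n_2,n_3)=(1,1,a)$ with $a\ge3$ (and $k=3$); (b) $(n_1,n_2,n_3,n_4)=(1,1,1,1)$ (and $k=4$).
   Context: Work over a field of characteristic zero (not necessarily algebraically closed). $\mathbf{P}^{n_1}\times\cdots\times\mathbf{P}^{n_k}$ denotes the Segre variety embedded in $\mathbf{P}(V_1\otimes\cdots\otimes V_k)$, where $\dim V_i=n_i+1$. For a variety $X\subseteq\mathbf{P}^m$, the $s$-secant variety $\sigma_s(X)$ is the Zariski closure of the union of the linear spans of $s$-tuples of points of $X$. For the Segre variety $X$, $\sigma_s(X)$ is called non-defective if it has the expected dimension $\min\{\prod_{i=1}^k(n_i+1)-1,\ s\sum_{i=1}^kn_i+s-1\}$, and defective if its dimension is smaller. *)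

(* Defs.v *)
From HB Require Import structures.
From mathcomp Require Import all_boot all_order all_algebra.
From mathcomp.multinomials Require Import mpoly.

Set Implicit Arguments.
Unset Strict Implicit.
Unset Printing Implicit Defensive.

Import GRing.Theory.
Local Open Scope ring_scope.

(* A set of points of P^(N-1) is represented by the set of all its homogeneous
   coordinate vectors, i.e. by a predicate on nonzero vectors of F^N. *)
Section ProjectiveGeometry.
Variables (F : fieldType) (N : nat).
Implicit Types (X Z : 'rV[F]_N -> Prop) (P Q : {pred {mpoly F[N]}}).

Definition homog_vanishing Z (p : {mpoly F[N]}) : Prop :=
  (exists d, p \is d.-homog) /\ (forall v, Z v -> p.@[v ord0] = 0).

Definition zariski_closure Z (v : 'rV[F]_N) : Prop :=
  v != 0 /\ (forall p, homog_vanishing Z p -> p.@[v ord0] = 0).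

Definition span_union X (s : nat) (v : 'rV[F]_N) : Prop :=
  v != 0 /\ (exists M : 'M[F]_(s, N),
    (forall i, X (row i M)) /\ (v <= M)%MS).

Definition secant_variety X (s : nat) : 'rV[F]_N -> Prop :=
  zariski_closure (span_union X s).

(* The dimension of a closed set Z is the Krull dimension of the closed
   subscheme Proj (F[x]/I(Z)) of projective space.  Irreducible closed subsets
   of that scheme correspond, inclusions being reversed, to the homogeneous
   prime ideals containing I(Z) but not the irrelevant ideal.  Working with
   primes rather than with sets of F-rational points gives the right notion of
   dimension when F is not algebraically closed. *)
Definition homogeneous_ideal P : Prop :=
  forall p d, p \in P -> pihomog mdeg d p \in P.

(* [idealr_closed] includes properness.  Predicates are boolean, as in
   ring_quotient; classically every ideal is of this form. *)
Definition proj_point Z P : Prop :=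
  [/\ idealr_closed P, prime_idealr_closed P, homogeneous_ideal P,
      (exists i : 'I_N, 'X_i \notin P)
    & forall p, homog_vanishing Z p -> p \in P].

Definition strictly_included P Q : Prop :=
  {subset P <= Q} /\ ~ {subset Q <= P}.

Definition has_chain Z (d : nat) : Prop :=
  exists P : 'I_d.+1 -> {pred {mpoly F[N]}},
    (forall i, proj_point Z (P i)) /\
    (forall i j : 'I_d.+1, (i < j)%N -> strictly_included (P i) (P j)).

Definition has_dim Z (d : nat) : Prop :=
  has_chain Z d /\ (forall e, has_chain Z e -> (e <= d)%N).

End ProjectiveGeometry.

(* The tensor product of the F^(n i + 1), i < k, in coordinates: multi-indices
   enumerate the basis of elementary tensors of basis vectors. *)
Section Segre.
Variables (F : fieldType) (k : nat) (n : 'I_k -> nat).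

Definition multi_index := {dffun forall i : 'I_k, 'I_(n i).+1}.

Definition pure_tensor (a : forall i : 'I_k, 'rV[F]_(n i).+1) :
    'rV[F]_#|{: multi_index}| :=
  \row_j \prod_(i < k) a i ord0 ((enum_val j : multi_index) i).

Definition segre (v : 'rV[F]_#|{: multi_index}|) : Prop :=
  v != 0 /\ exists a, v = pure_tensor a.

Definition segre_secant (s : nat) : 'rV[F]_#|{: multi_index}| -> Prop :=
  secant_variety segre s.

(* Meant for s > 0: for s = 0 the subtraction is truncated. *)
Definition expected_dim (s : nat) : nat :=
  (minn (\prod_(i < k) (n i).+1 - 1) (s * (\sum_(i < k) n i) + s - 1))%N.

Definition nondefective (s : nat) : Prop :=
  has_dim (segre_secant s) (expected_dim s).

Definition defective (s : nat) : Prop :=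
  exists2 d, has_dim (segre_secant s) d & (d < expected_dim s)%N.

End Segre.

Arguments segre F {k} n v.
Arguments segre_secant F {k} n s v.
Arguments nondefective F {k} n s.
Arguments defective F {k} n s.

(* Main.v *)
Require Import Defs.
From mathcomp Require Import all_boot all_order all_algebra.
From mathcomp.multinomials Require Import mpoly.
From mathcomp Require Import zify ring.
From Stdlib Require Import Classical_Prop.
Import GRing.Theory.

Set Implicit Arguments.
Unset Strict Implicit.
Unset Printing Implicit Defensive.

Local Open Scope ring_scope.

(** Write phi for the polynomial map sending three k-tuples of vectors to the sum
of the three pure tensors that they define; the third secant variety is the
closure of the image of phi.

Dimension is Krull dimension, so two facts link chains of homogeneous primes to
parametrizations.  Both rest on algebraic independence modulo a prime.

Upper bound ([chain_length_lt]).  If P is strictly contained in Q and g lies in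
Q but not in P, then adding g to a family independent modulo Q gives a family
independent modulo P.  Starting from the irrelevant ideal, a chain of d + 1
primes therefore gives d + 1 polynomials independent modulo the ideal of the
variety.  If a map psi in r variables has dense image in the variety, they stay
independent after composition with psi, so d + 1 <= r, because more than r
polynomials in r variables are dependent ([alg_dependent]).

Lower bound ([has_chain_of_immersion]).  Let Psi be a map in m variables whose
values, up to scalars, lie in the variety, and such that Psi(0) and the m partial
derivatives at 0 are linearly independent.  The ideals of the cones over the
images of F^0, F^1, ..., F^m are homogeneous primes, and they are pairwise
distinct: by the Jacobian criterion ([alg_indep_of_jacobian]) the cone over
F^u carries u + 1 independent functions, and the cone over F^u' with u' < u
does not.

The upper bound is used with the identity map, which gives the dimension of the
ambient space, and with tensors whose factors have first coordinate 1, which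
gives 3 * (n_1 + ... + n_k) + 2; together these give the expected dimension.  In
the exceptional cases a smaller parametrization exists.  For (1, 1, a), flatten
to matrices with 4 rows: their rank is at most 3, so three rows generically
determine the last one up to three coefficients.  For (1, 1, 1, 1), three points
of P^1 can be moved to any other three points by a projectivity, so a general
point of the secant variety is the image of a binary quartic, that is of a
symmetric tensor, under id (x) g_2 (x) g_3 (x) g_4: this takes 5 + 3 * 3 = 14
parameters, and 15 are expected.

The lower bound is Terracini's lemma at the points e_0 (x) ... (x) e_0,
e_1 (x) ... (x) e_1 and w_1 (x) ... (x) w_k, where w_i is e_2 if n_i >= 2 and
e_0 + e_1 if n_i = 1.  The first two tangent spaces are spanned by the basis
tensors whose multi-index differs in at most one place from 0...0 or from 1...1;
for k >= 3 these are distinct, so it is enough to study the third tangent space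
at the multi-indices that are far from both ([secant_chain_of_third_point]).
Let o be the number of i with n_i = 1 and e the number of the others.  If
o + 2 e >= 5 there are enough far multi-indices to separate the third tangent
space ([secant_chain_nonfilling]).  The remaining cases with k >= 3 are
(1, 1, 1), (1, 1, a) and (1, 1, 1, 1): in (1, 1, 1) and (1, 1, 2) the tangent
spaces fill the whole space, and the others are the exceptions. *)

(** * Polynomials over a field of characteristic zero *)

Local Notation widen := (widen_ord (leqnSn _)).

Lemma mmap_muni (n : nat) (R : comNzRingType) (S : comNzRingType)
    (f : {rmorphism R -> S}) (h : 'I_n.+1 -> S) (p : {mpoly R[n.+1]}) :
  mmap f h p =
    (map_poly (mmap f (fun i => h (widen i))) (muni p)).[h ord_max].
Proof.
rewrite muniE rmorph_sum horner_sum; apply: eq_bigr => m _ /=.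
rewrite -mul_polyC rmorphM /= map_polyC /= map_polyXn hornerCM hornerXn.
rewrite mmapZ mmapX -mulrA; congr (_ * _).
rewrite /mmap1 big_ord_recr /=; congr (_ * _).
by apply: eq_bigr => i _; rewrite mnmE.
Qed.

Lemma muni_eq0 n (R : comNzRingType) (p : {mpoly R[n.+1]}) : muni p = 0 -> p = 0.
Proof.
move=> p0; have := mmap_muni (@mpolyC n.+1 R) (fun i => 'X_i) p.
rewrite p0 rmorph0 horner0 => <-; rewrite {1}[p]mpolyE; apply: eq_bigr => m _.
by rewrite mmap1_id mul_mpolyC.
Qed.

Section Char0.
Variable F : fieldType.
Hypothesis charF0 : [pchar F]%R =i pred0.

Lemma natr_inj_char0 : injective (fun n => n%:R : F).
Proof.
move=> a b; wlog ab : a b / (a <= b)%N.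
  move=> W e; have [ab|/ltnW ba] := leqP a b; first exact: W.
  by apply/esym/W.
move=> e; have : (b - a)%:R == 0 :> F by rewrite natrB // e subrr.
by rewrite ((pcharf0P F).1 charF0) subn_eq0 => ba; apply/eqP; rewrite eqn_leq ab.
Qed.

(** A field of characteristic zero is infinite, so removing the zeros of [d]
leaves infinitely many points.  In this form the lemma also extends identities
from general points to all points. *)
Lemma horner_eq0_cofinite (p d : {poly F}) :
  d != 0 -> (forall x, d.[x] != 0 -> p.[x] = 0) -> p = 0.
Proof.
move=> d0 pd; apply/eqP; apply: contraT => p0.
have q0 : p * d != 0 by rewrite mulf_neq0.
pose s := [seq i%:R : F | i <- iota 0 (size (p * d))].
have := max_poly_roots q0 (rs := s); rewrite size_map size_iota ltnn.
move=> -> //; last by rewrite map_inj_uniq ?iota_uniq //; exact: natr_inj_char0.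
apply/allP => x _; rewrite /root hornerM.
by have [->|/pd ->] := eqVneq d.[x] 0; rewrite ?mulr0 ?mul0r.
Qed.

Lemma horner_eq0 (p : {poly F}) : (forall x, p.[x] = 0) -> p = 0.
Proof. by move=> p0; apply: (@horner_eq0_cofinite p 1) => //; exact: oner_neq0. Qed.

Lemma meval_eq0 n (p : {mpoly F[n]}) : (forall v, p.@[v] = 0) -> p = 0.
Proof.
elim: n p => [|n IH] p p0.
  rewrite (nvar0_mpolyC p); have := p0 (fun _ => 0).
  by rewrite {1}(nvar0_mpolyC p) mevalC => ->; rewrite mpolyC0.
apply: muni_eq0; apply/polyP => i; rewrite coef0; apply: IH => v.
  have : map_poly (meval v) (muni p) = 0.
    apply: horner_eq0 => x.
    pose w (i : 'I_n.+1) := if unlift ord_max i is Some j then v j else x.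
    rewrite -(p0 w) /meval mmap_muni /w unlift_none.
    congr (_.[_]); apply: eq_map_poly => q; apply: meval_eq => j.
    suff -> : widen j = lift ord_max j by rewrite liftK.
    by apply: val_inj; rewrite /= /bump leqNgt ltn_ord.
  by move/polyP/(_ i); rewrite coef_map coef0.
Qed.

Lemma meval_inj n (p q : {mpoly F[n]}) : (forall v, p.@[v] = q.@[v]) -> p = q.
Proof.
by move=> pq; apply/eqP; rewrite -subr_eq0; apply/eqP/meval_eq0 => v;
   rewrite mevalB pq subrr.
Qed.

Lemma comp_mpolyA n m k (p : {mpoly F[n]}) (f : n.-tuple {mpoly F[m]})
    (g : m.-tuple {mpoly F[k]}) :
  (p \mPo f) \mPo g = p \mPo [tuple tnth f i \mPo g | i < n].
Proof.
apply: meval_inj => v; rewrite !comp_mpoly_meval; apply: meval_eq => i.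
by rewrite tnth_mktuple comp_mpoly_meval.
Qed.

Lemma mderiv_comp n m (p : {mpoly F[n]}) (f : n.-tuple {mpoly F[m]}) l :
  (p \mPo f)^`M(l) = \sum_(i < n) (p^`M(i) \mPo f) * (tnth f i)^`M(l).
Proof.
have H1 i : 'X_i \mPo f = tnth f i by rewrite comp_mpolyXU -tnth_nth.
have step (q : {mpoly F[n]}) i :
    (q \mPo f)^`M(l) = \sum_j (q^`M(j) \mPo f) * (tnth f j)^`M(l) ->
    ((q * 'X_i) \mPo f)^`M(l)
      = \sum_j ((q * 'X_i)^`M(j) \mPo f) * (tnth f j)^`M(l).
  move=> IH; rewrite rmorphM /= mderivM IH H1.
  under [RHS]eq_bigr => j _.
    rewrite mderivM rmorphD /= !rmorphM /= H1 mulrDl mulrAC.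
    over.
  rewrite big_split /= mulr_suml; congr (_ + _).
  rewrite (bigD1 i) //= big1 => [|j ji].
    rewrite mderivX mnm1E eqxx scale1r.
    rewrite (_ : (U_(i) - U_(i))%MM = 0%MM) ?mpolyX0 ?comp_mpoly1 ?addr0 ?mulr1 //.
    by apply/mnmP => a; rewrite mnmBE subnn mnm0E.
  by rewrite mderivX mnm1E eq_sym (negbTE ji) scale0r comp_mpoly0 mulr0 mul0r.
elim/mpolyind: p => [|c a p _ _ IH].
  by rewrite comp_mpoly0 mderiv0 big1 // => i _; rewrite mderiv0 comp_mpoly0 mul0r.
rewrite comp_mpolyD mderivD IH comp_mpolyZ mderivZ.
have -> : ('X_[a] \mPo f)^`M(l) = \sum_j ('X_[a]^`M(j) \mPo f) * (tnth f j)^`M(l).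
  have [s ->] : exists s : seq 'I_n, 'X_[a] = \prod_(i <- s) 'X_i :> {mpoly F[n]}.
    exists (flatten [seq nseq (a i) i | i <- enum 'I_n]).
    rewrite mpolyXE_id big_flatten big_map big_enum /=; apply: eq_bigr => i _.
    by rewrite big_nseq -Monoid.iteropE.
  elim: s => [|i s IHs].
    rewrite big_nil comp_mpoly1 -mpolyC1 mderivC big1 // => i _.
    by rewrite -mpolyC1 mderivC comp_mpoly0 mul0r.
  by rewrite big_cons mulrC; apply: step.
rewrite scaler_sumr -big_split; apply: eq_bigr => i _ /=.
by rewrite mderivD mderivZ comp_mpolyD comp_mpolyZ mulrDl scalerAl.
Qed.

(** * Algebraic independence *)

(** The Jacobian criterion.  For a relation G of least degree, the chain rule
makes the vector of the partial derivatives of G at f a linear relation between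
the rows of the Jacobian matrix; so these vanish, they are relations of smaller
degree, hence zero, and in characteristic zero G is then constant. *)
Lemma alg_indep_of_jacobian e m (G : {mpoly F[e]}) (f : e.-tuple {mpoly F[m]})
    (x : 'I_m -> F) :
  row_free (\matrix_(i < e, l < m) ((tnth f i)^`M(l)).@[x]) ->
  G \mPo f = 0 -> G = 0.
Proof.
set A := \matrix_(i, l) _ => /row_freeP [B AB].
have [k] := ubnP (msize G); elim: k G => // k IH G szG Gf0.
pose J : 'M[{mpoly F[m]}]_(e, m) := \matrix_(i, l) (tnth f i)^`M(l).
pose q : 'rV[{mpoly F[m]}]_e := \row_i (G^`M(i) \mPo f).
have qJ : q *m J = 0.
  apply/rowP => l; transitivity ((G \mPo f)^`M(l)); last by rewrite Gf0 mderiv0 mxE.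
  by rewrite mderiv_comp mxE; apply: eq_bigr => i _; rewrite !mxE.
(* A right inverse of A over F makes J right invertible up to a determinant
   that is nonzero at x, hence nonzero. *)
pose D := J *m map_mx (@mpolyC m F) B.
have D0 : \det D != 0.
  apply: contraTneq (oner_neq0 F) => D0.
  rewrite negbK -(meval0 x) -D0 -det_map_mx map_mxM -map_mx_comp.
  rewrite (_ : map_mx _ J = A); last by apply/matrixP => i l; rewrite !mxE.
  rewrite (_ : map_mx _ B = B); last by apply/matrixP => i l; rewrite !mxE /= mevalC.
  by rewrite AB det1.
have q0 : q = 0.
  have : q *m (D *m \adj D) = 0 by rewrite !mulmxA qJ !mul0mx.
  rewrite mul_mx_adj mul_mx_scalar => /rowP qd; apply/rowP => i.
  by have /eqP := qd i; rewrite !mxE mulf_eq0 (negbTE D0) => /eqP.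
have dG i : G^`M(i) = 0.
  have [->|G0] := eqVneq G 0; first exact: mderiv0.
  apply: IH; last by have /rowP/(_ i) := q0; rewrite !mxE.
  apply: leq_trans (_ : msize G <= k)%N; last by rewrite -ltnS.
  have [->|Gi0] := eqVneq (G^`M(i)) 0; first by rewrite msize0 lt0n msize_poly_eq0.
  rewrite -(mlead_deg Gi0).
  have := mlead_supp Gi0; rewrite mcoeff_msupp mcoeff_mderiv => h.
  have : (mlead G^`M(i) + U_(i))%MM \in msupp G.
    by rewrite mcoeff_msupp; apply: contraNneq h => ->; rewrite mul0rn.
  by move/msize_mdeg_lt; rewrite mdegD mdeg1 addn1.
have GC : G = (G@_0%MM)%:MP.
  apply/mpolyP => a; rewrite mcoeffC; have [->|a0] := eqVneq; first by rewrite mulr1.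
  have [i ai] : exists i, a i != 0%N.
    by apply/existsP; apply: contraR a0; rewrite negb_exists => /forallP a0;
       apply/eqP/mnmP => i; rewrite mnm0E; apply/eqP; move: (a0 i); rewrite negbK.
  have := mcoeff_mderiv i G (a - U_(i))%MM; rewrite dG mcoeff0 submK; last first.
    by apply/mnm_lepP => j; rewrite mnm1E; case: eqP => // <-; rewrite lt0n.
  rewrite mulr0 => /esym/eqP; rewrite -mulr_natl mulf_eq0 ((pcharf0P F).1 charF0) /=.
  by move/eqP.
by apply/eqP; move/eqP: Gf0; rewrite GC comp_mpolyC !mpolyC_eq0.
Qed.

(** Count monomials: there are L ^ e monomials in f with exponents below L, and
all are combinations of the monomials in m variables with exponents below
L * K.  The former number is larger for L large, since m < e. *)
Lemma alg_dependent e m (f : e.-tuple {mpoly F[m]}) :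
  (m < e)%N -> exists2 G : {mpoly F[e]}, G != 0 & G \mPo f = 0.
Proof.
move=> me; pose D := (\max_(i < e) msize (tnth f i))%N.
pose K := (e * D).+1; pose L := (K ^ m).+1; pose b := (L * K)%N.
pose mon (a : {ffun 'I_e -> 'I_L}) : 'X_{1..e} := [multinom (a i : nat) | i < e].
pose box (a : {ffun 'I_m -> 'I_b}) : 'X_{1..m} := [multinom (a i : nat) | i < m].
pose A := \matrix_(x < #|{: {ffun 'I_e -> 'I_L}}|, y < #|{: {ffun 'I_m -> 'I_b}}|)
  ('X_[mon (enum_val x)] \mPo f)@_(box (enum_val y)).
have small a y : y \in msupp ('X_[mon a] \mPo f) -> forall i, (y i < b)%N.
  move=> ysupp i; apply: leq_ltn_trans (_ : L * (e * D) < b)%N; last first.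
    by rewrite /b ltn_pmul2l // /K.
  apply: leq_trans (_ : mdeg y <= _)%N; first by rewrite mdegE (bigD1 i) ?leq_addr.
  rewrite -ltnS; apply: leq_trans (msize_mdeg_lt ysupp) _.
  rewrite comp_mpolyX.
  have leM (p q : {mpoly F[m]}) : (msize (p * q) <= (msize p + msize q).-1)%N.
    have [->|p0] := eqVneq p 0; first by rewrite mul0r msize0.
    have [->|q0] := eqVneq q 0; first by rewrite mulr0 msize0.
    by rewrite msizeM.
  have H (g : {mpoly F[m]}) j : (msize (g ^+ j) <= (j * msize g).+1)%N.
    elim: j => [|j IH]; first by rewrite expr0 msize1.
    rewrite exprS; apply: leq_trans (leM _ _) _; rewrite mulSn.
    by move: IH; lia.
  have H2 (g : 'I_e -> {mpoly F[m]}) (c : nat) (s : seq 'I_e) :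
      (forall j, msize (g j) <= c.+1)%N ->
      (msize (\prod_(j <- s) g j) <= (size s * c).+1)%N.
    move=> gc; elim: s => [|j s IH]; first by rewrite big_nil msize1.
    rewrite big_cons; apply: leq_trans (leM _ _) _; rewrite /= mulSn.
    have ar (u v w : nat) : (v <= w.+1 -> u <= c.+1 -> (u + v).-1 <= (c + w).+1)%N.
      by clear; lia.
    exact: ar IH (gc j).
  apply: leq_trans (H2 _ (L * D)%N _ _) _ => [j|].
    apply: leq_trans (H _ _) _; rewrite ltnS leq_mul //.
      by rewrite mnmE ltnW.
    exact: (@leq_bigmax _ (fun i => msize (tnth f i)) j).
  by rewrite ltnS -[index_enum _]enumT size_enum_ord mulnCA.
have [c c0 cA] : exists2 c : 'rV_#|{: {ffun 'I_e -> 'I_L}}|, c != 0 & c *m A = 0.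
  have : ~~ row_free A.
    rewrite /row_free neq_ltn; apply/orP; left.
    apply: leq_ltn_trans (rank_leq_col A) _; rewrite !card_ffun !card_ord.
    apply: leq_trans (_ : L ^ m.+1 <= _)%N; last by rewrite leq_pexp2l.
    by rewrite expnMn expnS mulnC ltn_pmul2r ?expn_gt0.
  rewrite -kermx_eq0 => /rowV0Pn [c cK c0]; exists c => //.
  exact/sub_kermxP.
pose G : {mpoly F[e]} := \sum_x c 0 x *: 'X_[mon (enum_val x)].
have mon_inj : injective mon.
  by move=> a a' aa; apply/ffunP => i; apply: val_inj;
     have /mnmP/(_ i) := aa; rewrite !mnmE.
exists G.
  apply: contraNneq c0 => G0; apply/eqP/rowP => x; rewrite mxE.
  rewrite -[RHS](mcoeff0 _ (mon (enum_val x))) -G0 raddf_sum /= (bigD1 x) //=.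
  rewrite mcoeffZ mcoeffX eqxx mulr1 big1 ?addr0 // => x' xx.
  by rewrite mcoeffZ mcoeffX (inj_eq mon_inj) (inj_eq enum_val_inj) (negbTE xx) mulr0.
apply/mpolyP => y; rewrite mcoeff0 /G (raddf_sum (comp_mpoly f)) raddf_sum /=.
have [/forallP yb|] := boolP [forall i, y i < b]%N.
  pose y' : {ffun 'I_m -> 'I_b} := [ffun i => Ordinal (yb i)].
  have -> : y = box y' by apply/mnmP => i; rewrite mnmE ffunE.
  have /rowP/(_ (enum_rank y')) := cA; rewrite !mxE => cAy.
  by rewrite -[RHS]cAy; apply: eq_bigr => x _; rewrite !mxE enum_rankK comp_mpolyZ mcoeffZ.
case/forallPn => i yi; rewrite big1 // => x _.
rewrite comp_mpolyZ mcoeffZ; apply/eqP; rewrite mulf_eq0; apply/orP; right.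
rewrite -[_ == 0]negbK -mcoeff_msupp; apply: contra yi => /small; exact.
Qed.

(** For a prime [P] this says that the quotient by [P] has transcendence degree
at least [e] over [F]. *)
Definition indep_mod N (P : {pred {mpoly F[N]}}) (e : nat) :=
  exists f : e.-tuple {mpoly F[N]}, forall G, G \mPo f \in P -> G = 0.

(** Let g lie in Q but not in P.  In a relation between f and g modulo P, the
part free of g is a relation between f modulo Q, hence zero; so the relation is
divisible by g, and g can be cancelled modulo P. *)
Lemma indep_modS N (P Q : {pred {mpoly F[N]}}) e :
  idealr_closed P -> prime_idealr_closed P -> idealr_closed Q ->
  strictly_included P Q -> indep_mod Q e -> indep_mod P e.+1.
Proof.
move=> [P0 P1 PD] Ppr [Q0 Q1 QD] [PQ nQP] [f fQ].
have [g gQ gP] : exists2 g, g \in Q & g \notin P.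
  apply: NNPP => no; apply: nQP => g gQ; rewrite -[_ \in _]negbK.
  by apply/negP => gP; apply: no; exists g.
exists [tuple if unlift ord_max i is Some j then tnth f j else g | i < e.+1] => G.
rewrite /comp_mpoly mmap_muni tnth_mktuple unlift_none.
have -> : map_poly (mmap (@mpolyC N F) (fun i => tnth
    [tuple if unlift ord_max i is Some j then tnth f j else g | i < e.+1]
    (widen i))) (muni G) = map_poly (comp_mpoly f) (muni G).
  apply: eq_map_poly => q; rewrite /comp_mpoly.
  apply: eq_bigr => a _; congr (_ * _); apply: mmap1_eq => i.
  rewrite tnth_mktuple (_ : widen i = lift ord_max i) ?liftK //.
  by apply: val_inj; rewrite /= /bump leqNgt ltn_ord.
move=> GP; apply: muni_eq0.
elim/poly_ind: (muni G) GP => // q c IH.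
rewrite rmorphD rmorphM /= map_polyX map_polyC /= !hornerE => qP.
have c0 : c = 0.
  apply: fQ; have := QD (- (map_poly (comp_mpoly f) q).[g]) _ _ gQ (PQ _ qP).
  by rewrite mulNr addKr.
move: qP; rewrite c0 comp_mpoly0 addr0 addr0 => /Ppr.
by rewrite (negbTE gP) orbF => /IH ->; rewrite mul0r.
Qed.

(** * Chains of homogeneous primes *)

Lemma meval_homog_scale N d (p : {mpoly F[N]}) a (v : 'I_N -> F) :
  p \is d.-homog -> p.@[fun i => a * v i] = a ^+ d * p.@[v].
Proof.
move=> /dhomogP ph; rewrite !mevalE mulr_sumr; apply: eq_big_seq => x xp.
rewrite mulrCA; congr (_ * _); under eq_bigr do rewrite exprMn.
by rewrite big_split -(ph _ xp) /= mdegE expr_sum.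
Qed.

(** On the line through v, the components of p are the coefficients of a
polynomial in one variable. *)
Lemma pihomog_meval_eq0 N (p : {mpoly F[N]}) (v : 'I_N -> F) :
  (forall a, a != 0 -> p.@[fun i => a * v i] = 0) ->
  forall d, (pihomog mdeg d p).@[v] = 0.
Proof.
move=> p0 d; pose k := maxn (msize p) d.+1.
have dk : (d < k)%N by rewrite leq_max leqnn orbT.
pose q := \poly_(e < k) (pihomog mdeg e p).@[v].
suff q0 : q = 0 by have := coef_poly k (fun e => (pihomog mdeg e p).@[v]) d;
  rewrite -/q q0 coef0 dk.
apply: (@horner_eq0_cofinite q 'X); first by rewrite polyX_eq0.
move=> a; rewrite hornerX => /p0 <-; rewrite horner_poly.
rewrite [in RHS](@pihomog_partitionE N F mdeg k p) ?leq_maxl // raddf_sum /=.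
by apply: eq_bigr => e _; rewrite (meval_homog_scale _ _ (pihomogP _ _ _)) mulrC.
Qed.

Section Chains.
Variable N : nat.
Implicit Types (Z : 'rV[F]_N -> Prop).

(** Each inclusion in the chain raises the number of independent elements by one.
A last inclusion comes for free, from the top of the chain into the irrelevant
ideal M. *)
Lemma chain_indep Z d : has_chain Z d ->
  exists2 P, proj_point Z P & indep_mod P d.+1.
Proof.
move=> [P [Pp Pchain]].
pose M : {pred {mpoly F[N]}} := [pred p : {mpoly F[N]} | p@_0%MM == 0].
have MP p : p \in M = (p@_0%MM == 0) by [].
have idM : idealr_closed M.
  split; rewrite ?MP ?mcoeff0 // ?mcoeff1 ?eqxx ?oner_eq0 // => a p q.
  rewrite !MP => /eqP p0 /eqP q0.
  by rewrite mcoeffD q0 addr0 (rmorphM (mcoeff 0)) /= p0 mulr0.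
have M0 : indep_mod M 0.
  exists [tuple] => G; rewrite (nvar0_mpolyC G) comp_mpolyC MP.
  by rewrite mcoeffC eqxx mulr1 => /eqP ->; rewrite mpolyC0.
have key j : (j <= d)%N -> indep_mod (P (inord (d - j))) j.+1.
  elim: j => [|j IH] jd.
    have [Pi Ppr Ph [i Xi] _] := Pp (inord (d - 0)).
    apply: indep_modS idM _ M0 => //; split.
      move=> p pP; have := Ph p 0%N pP; rewrite MP.
      have -> : pihomog mdeg 0 p = (p@_0%MM)%:MP.
        apply/mpolyP => x; rewrite mcoeffC /pihomog; have [->|x0] := eqVneq.
          rewrite mulr1 raddf_sum /=; have [p0|p0] := boolP (0%MM \in msupp p).
            rewrite big_mkcond (bigD1_seq 0%MM) //= mdeg0 eqxx mcoeffZ mcoeffX.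
            rewrite eqxx mulr1 big1 ?addr0 // => y /negbTE y0.
            by case: ifP => // _; rewrite mcoeffZ mcoeffX y0 mulr0.
          rewrite memN_msupp_eq0 // big1_seq // => y /andP[_ yp].
          rewrite mcoeffZ mcoeffX; case: eqP yp => [->|]; rewrite ?mulr0 //.
          by rewrite (negbTE p0).
        rewrite mulr0 raddf_sum /= big1 // => y.
        rewrite mdeg_eq0 => /eqP ->; rewrite mcoeffZ mcoeffX eq_sym.
        by rewrite (negbTE x0) mulr0.
      have [_ P1 PD] := Pi; have [//|c0 cP] := eqVneq.
      case/negP: P1; have := PD ((p@_0%MM)^-1)%:MP _ 0 cP; rewrite addr0.
      by rewrite -mpolyCM mulVf // mpolyC1; apply; case: Pi.
    move/(_ 'X_i); rewrite MP mcoeffX -mdeg_eq0 mdeg1 eqxx => /(_ isT).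
    exact/negP.
  have [Pi Ppr _ _ _] := Pp (inord (d - j.+1)).
  have [Qi _ _ _ _] := Pp (inord (d - j)).
  apply: indep_modS Qi _ (IH (ltnW jd)) => //.
  by apply: Pchain; rewrite !inordK //; lia.
by exists (P (inord (d - d))) => //; apply: key.
Qed.

(** The second hypothesis says that the image of [psi] is dense in [Z], and [Z] is
a cone so that the homogeneous components of a polynomial vanishing on [Z] vanish
there too. *)
Lemma chain_length_lt Z r (psi : N.-tuple {mpoly F[r]}) :
  (forall v a, Z v -> a != 0 -> Z (a *: v)) ->
  (forall p, p \mPo psi = 0 -> forall v, Z v -> p.@[v ord0] = 0) ->
  forall d, has_chain (zariski_closure Z) d -> (d < r)%N.
Proof.
move=> Zcone Zpsi d /chain_indep [P [[P0 _ PD] _ _ _ PZ] [f fP]].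
rewrite ltnNge; apply/negP => rd.
have [G G0 Gf] := @alg_dependent _ _ [tuple tnth f i \mPo psi | i < d.+1] rd.
case/eqP: G0; apply: fP; set p := G \mPo f.
have pZ v : Z v -> p.@[v ord0] = 0.
  by apply: Zpsi; rewrite comp_mpolyA.
rewrite (pihomog_partitionE (leqnn (msize p))).
elim/big_ind: _ => [//|x y xP yP|i _].
  by have := PD 1 x y xP yP; rewrite mul1r.
apply: PZ; split=> [|v [_ vZ]]; first by exists i; apply: pihomogP.
apply: vZ; split=> [|w Zw]; first by exists i; apply: pihomogP.
apply: pihomog_meval_eq0 => a a0; rewrite -(pZ _ (Zcone w a Zw a0)).
by apply: meval_eq => j; rewrite mxE.
Qed.

Section LowerBound.
Variables (m : nat) (Z : 'rV[F]_N -> Prop) (Psi : N.-tuple {mpoly F[m]}).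
Hypothesis PsiZ : forall a s, let v := \row_c (a * (tnth Psi c).@[s]) in
  v != 0 -> Z v.
Hypothesis Psi_indep : forall a (s : 'I_m -> F),
  (forall c, a * (tnth Psi c).@[fun=> 0]
     + \sum_l s l * ((tnth Psi c)^`M(l)).@[fun=> 0] = 0) ->
  a = 0 /\ forall l, s l = 0.

(** The variable 0 of the cone over the image of F^u is the scaling factor, and the
variable l + 1 stands for the variable l of [Psi]. *)
Let trunc u (t : 'I_u.+1 -> F) (l : 'I_m) : F :=
  if (l < u)%N then t (inord l.+1) else 0.

Let cone u : N.-tuple {mpoly F[u.+1]} :=
  [tuple 'X_ord0 * (tnth Psi c \mPo
     [tuple if (l < u)%N then 'X_(inord l.+1) else 0 | l < m]) | c < N].

Let coneE u c t : (tnth (cone u) c).@[t] = t ord0 * (tnth Psi c).@[trunc t].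
Proof.
rewrite tnth_mktuple mevalM mevalXU comp_mpoly_meval; congr (_ * _).
apply: meval_eq => l; rewrite tnth_mktuple /trunc.
by case: ifP => _; rewrite ?mevalXU ?meval0.
Qed.

Let P u : {pred {mpoly F[N]}} := [pred G : {mpoly F[N]} | G \mPo cone u == 0].

Let PP u G : G \in P u <->
  forall t : 'I_u.+1 -> F, G.@[fun c => t ord0 * (tnth Psi c).@[trunc t]] = 0.
Proof.
have E (t : 'I_u.+1 -> F) : (G \mPo cone u).@[t]
    = G.@[fun c => t ord0 * (tnth Psi c).@[trunc t]].
  by rewrite comp_mpoly_meval; apply: meval_eq => c; rewrite coneE.
split=> [/eqP G0 t|G0]; first by rewrite -E G0 meval0.
by apply/eqP/meval_eq0 => t; rewrite E.
Qed.

Let base_pt u (i : 'I_u.+1) : F := (i == ord0)%:R.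
Let truncb u l : trunc (@base_pt u) l = 0.
Proof.
rewrite /trunc /base_pt; case: ifP => // lu.
by rewrite -val_eqE /= inordK.
Qed.

Let Psi_n0 : exists c, (tnth Psi c).@[fun=> 0] != 0.
Proof.
apply/existsP; rewrite -[X in is_true X]negbK; apply/negP.
rewrite negb_exists => /forallP no.
have [] := @Psi_indep 1 (fun=> 0) => [c|/eqP]; last by rewrite oner_eq0.
by move: (no c); rewrite negbK mul1r => /eqP ->; rewrite big1 ?addr0 // => l _; rewrite mul0r.
Qed.

Let proj_point_P u : proj_point (zariski_closure Z) (P u).
Proof.
split.
- split; rewrite ?inE ?comp_mpoly0 ?comp_mpoly1 ?oner_eq0 // => a p q.
  rewrite !inE => /eqP p0 /eqP q0.
  by rewrite rmorphD rmorphM /= p0 q0 mulr0 addr0.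
- by move=> p q; rewrite !inE rmorphM mulf_eq0.
- move=> p d /PP p0; apply/PP => t; apply: pihomog_meval_eq0 => a _.
  pose t' i := if i == ord0 then a * t i else t i.
  rewrite -(p0 t'); apply: meval_eq => c; rewrite /t' eqxx mulrA; congr (_ * _).
  apply: meval_eq => l; rewrite /trunc; case: ifP => // lu.
  by rewrite -val_eqE /= inordK.
- have [c c0] := Psi_n0; exists c; apply: contra c0 => /PP/(_ (@base_pt u)).
  rewrite mevalXU /base_pt eqxx mul1r => c0; apply/eqP; rewrite -[RHS]c0.
  by apply: meval_eq => l; rewrite truncb.
(* Only the nonzero points of the cone are known to lie in Z, so multiply by a
   coordinate that does not vanish identically. *)
move=> p [ph p0]; have [c c0] := Psi_n0.
have : (p \mPo cone u) * tnth (cone u) c == 0.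
  apply/eqP/meval_eq0 => t; rewrite mevalM; have [->|tc0] := eqVneq ((tnth (cone u) c).@[t]) 0.
    by rewrite mulr0.
  pose v := \row_c (t ord0 * (tnth Psi c).@[trunc t]).
  have v0 : v != 0.
    by apply: contraNneq tc0 => /rowP/(_ c); rewrite coneE !mxE => ->.
  rewrite comp_mpoly_meval (meval_eq _ (v2 := v ord0)) ?p0 ?mul0r //.
    by split=> // q [_ q0]; apply: q0; apply: PsiZ.
  by move=> i; rewrite coneE mxE.
rewrite mulf_eq0 => /orP[//|/eqP c00]; case/eqP: c0.
rewrite -[RHS](meval0 (@base_pt u)) -c00 coneE /base_pt eqxx mul1r.
by apply: meval_eq => l; rewrite truncb.
Qed.

Let P_mono u u' : (u' <= u)%N -> {subset P u <= P u'}.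
Proof.
move=> uu G /PP G0; apply/PP => t.
pose t' (i : 'I_u.+1) := if (i <= u')%N then t (inord i) else 0.
rewrite -(G0 t'); apply: meval_eq => c; rewrite /t' /=; congr (_ * _).
  by congr (t _); apply: val_inj; rewrite /= inordK.
apply: meval_eq => l; rewrite /trunc; case: ifP => lu'.
  by rewrite (leq_trans lu' uu) inordK ?lu' ?(leq_trans lu' uu) // ltnS (leq_trans lu' uu).
by case: ifP => // lu; rewrite inordK ?ltnS // lu'.
Qed.

Let J : 'M[F]_(m.+1, N) := \matrix_(i, c)
  if unlift ord0 i is Some l then ((tnth Psi c)^`M(l)).@[fun=> 0]
  else (tnth Psi c).@[fun=> 0].

Let J_free : row_free J.
Proof.
apply: inj_row_free => v /rowP vJ.
have [|a0 s0] := @Psi_indep (v 0 0) (fun l => v 0 (lift ord0 l)).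
  move=> c; have := vJ c; rewrite !mxE big_ord_recl mxE unlift_none => e; rewrite -[RHS]e.
  by congr (_ + _); apply: eq_bigr => l _; rewrite mxE liftK.
by apply/rowP => i; rewrite mxE; case: (unliftP ord0 i) => [l|] ->.
Qed.

Let cone_deriv u (um : (u < m.+1)%N) (l : 'I_u.+1) c :
  ((tnth (cone u) c)^`M(l)).@[@base_pt u] = J (widen_ord um l) c.
Proof.
have tr0 (q : {mpoly F[m]}) : q.@[trunc (@base_pt u)] = q.@[fun=> 0].
  by apply: meval_eq => i; rewrite truncb.
have ev q : (q \mPo [tuple if (l < u)%N then 'X_(inord l.+1) else 0 | l < m]).@[@base_pt u]
    = q.@[fun=> 0].
  rewrite -tr0 comp_mpoly_meval; apply: meval_eq => i; rewrite tnth_mktuple /trunc.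
  by case: ifP => _; rewrite ?mevalXU ?meval0.
rewrite tnth_mktuple mderivM mevalD !mevalM ev mderiv_comp mderivX (raddf_sum (meval _)) /=.
rewrite mevalXU {2}/base_pt eqxx mul1r mnm1E mxE.
under eq_bigr => i _ do rewrite mevalM ev tnth_mktuple.
case: (unliftP ord0 l) => [l' ll|->].
  have lm : (l' < m)%N by apply: leq_trans (ltn_ord l') _.
  have -> : widen_ord um l = lift ord0 (Ordinal lm) by apply: val_inj; rewrite ll.
  rewrite liftK ll scale0r meval0 mul0r add0r (bigD1 (Ordinal lm)) //=.
  rewrite ltn_ord mderivX mnm1E big1 => [|i il].
    rewrite (_ : inord l'.+1 = lift ord0 l'); last first.
      by apply: val_inj; rewrite /= inordK // ltnS.
    rewrite eqxx scale1r (_ : (_ - _)%MM = 0%MM) ?mpolyX0 ?meval1 ?mulr1 ?addr0 //.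
    by apply/mnmP => a; rewrite mnmBE subnn mnm0E.
  case: ifP => iu; last by rewrite mderiv0 meval0 mulr0.
  rewrite mderivX mnm1E; case: eqP => [|_]; last by rewrite scale0r meval0 mulr0.
  move=> e; case/negP: il; move: e => /(congr1 val).
  by rewrite /= inordK // => -[ii]; apply/eqP/val_inj.
rewrite (_ : widen_ord um _ = ord0); last exact: val_inj.
rewrite unlift_none eqxx scale1r (_ : (_ - _)%MM = 0%MM); last first.
  by apply/mnmP => a; rewrite mnmBE subnn mnm0E.
rewrite mpolyX0 meval1 mul1r big1 ?addr0 // => i _; case: ifP => iu.
  rewrite mderivX mnm1E -val_eqE /= inordK //= scale0r meval0 mulr0 //.
by rewrite mderiv0 meval0 mulr0.
Qed.

(** Let B be a right inverse of J.  The linear forms given by the columns of B have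
an identity Jacobian on the cone over F^u, so they are independent there, but they
are u + 1 functions on a cone with u' + 1 parameters. *)
Let P_strict u u' : (u' < u <= m)%N -> ~ {subset P u' <= P u}.
Proof.
move=> /andP[uu um] sub; have um1 : (u < m.+1)%N by [].
have [B JB] := row_freeP J_free.
pose f := [tuple \sum_c B c (widen_ord um1 i) *: 'X_c | i < u.+1].
have [G G0 Gf] := @alg_dependent u.+1 u'.+1 [tuple tnth f i \mPo cone u' | i < u.+1] uu.
have /sub : G \mPo f \in P u' by rewrite inE comp_mpolyA Gf.
rewrite inE comp_mpolyA => /eqP GfP; case/eqP: G0.
apply: (alg_indep_of_jacobian (x := @base_pt u) _ GfP).
rewrite (_ : \matrix_(i, l) _ = 1%:M) ?row_free_unit ?unitmx1 //.
apply/matrixP => i l; rewrite !mxE !tnth_mktuple (raddf_sum (comp_mpoly _)) /=.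
rewrite (raddf_sum (mderiv l)) (raddf_sum (meval _)) /=.
have := congr1 (fun A : 'M_m.+1 => A (widen_ord um1 l) (widen_ord um1 i)) JB.
rewrite !mxE -val_eqE /= val_eqE eq_sym => <-; apply: eq_bigr => c _.
by rewrite comp_mpolyZ mderivZ mevalZ comp_mpolyXU -tnth_nth cone_deriv mulrC.
Qed.

(** A chart of the projective variety of dimension [m], given by a map that is
immersive at 0, carries a flag of subvarieties of dimensions 0, 1, ..., [m]. *)
Lemma has_chain_of_immersion : has_chain (zariski_closure Z) m.
Proof.
exists (fun j => P (m - j)); split=> [i|i j ij]; first exact: proj_point_P.
by split; [apply: P_mono; lia | apply: P_strict; move: (ltn_ord j); lia].
Qed.
End LowerBound.
End Chains.
End Char0.

(** * Upper bounds for the third secant variety *)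

Section Segre.
Variable F : fieldType.
Hypothesis charF0 : [pchar F]%R =i pred0.
Variables (k : nat) (n : 'I_k -> nat).
Hypothesis k_gt0 : (0 < k)%N.

Local Notation N := #|{: multi_index n}|.
Local Notation secant := (segre_secant F n 3).

(** Vectors are given by functions on [nat], of which only the first values matter:
this avoids types depending on the dimensions [n i].  The ring is arbitrary since
the map is also applied to vectors of polynomials. *)
Definition coord3 (R : comNzRingType) (a : 'I_3 -> 'I_k -> nat -> R) (v : 'I_k -> nat) : R :=
  \sum_j \prod_i a j i (v i).

Definition tensor3 (a : 'I_3 -> 'I_k -> nat -> F) : 'rV[F]_N :=
  \row_c coord3 a (fun i => (enum_val c : multi_index n) i).

(** The coefficients of a linear combination are absorbed in the first factors;
conversely a zero summand is replaced by any pure tensor with coefficient 0. *)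
Lemma span_unionP v : span_union (segre F n) 3 v <-> v != 0 /\ exists a, v = tensor3 a.
Proof.
split=> [[v0 [M [MX /submxP [w vw]]]]|[v0 [a va]]]; split=> //.
  have /fin_all_exists [b bP] j : exists b, row j M = pure_tensor b by case: (MX j).
  pose i0 := Ordinal k_gt0.
  exists (fun j i l => (if i == i0 then w 0 j else 1) * b j i ord0 (inord l)).
  apply/rowP => c; rewrite vw !mxE; apply: eq_bigr => j _.
  have := congr1 (fun r : 'rV_N => r 0 c) (bP j); rewrite !mxE => ->.
  rewrite big_split /=; congr (_ * _).
    by rewrite (bigD1 i0) //= big1 ?mulr1 // => i /negbTE ->.
  by apply: eq_bigr => i _; rewrite inord_val.
pose pt j : 'rV[F]_N := pure_tensor (fun i => \row_l a j i l).
pose one : 'rV[F]_N := pure_tensor (fun i => const_mx 1).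
have one0 : one != 0.
  pose y0 : multi_index n := finfun (fun i => ord0).
  apply/eqP => /rowP/(_ (enum_rank y0)); rewrite !mxE big1 => [/eqP|i _].
    by rewrite oner_eq0.
  by rewrite mxE.
exists (\matrix_(j < 3) if pt j == 0 then one else pt j); split=> [j|].
  rewrite rowK; have [p0|p0] := eqVneq (pt j) 0; split=> //.
    by exists (fun=> const_mx 1).
  by exists (fun i => \row_l a j i l).
apply/submxP; exists (\row_j if pt j == 0 then 0 else 1).
apply/rowP => c; rewrite va !mxE; apply: eq_bigr => j _.
have -> : \prod_i a j i ((enum_val c : multi_index n) i) = pt j 0 c.
  by rewrite mxE; apply: eq_bigr => i _; rewrite mxE.
rewrite [X in _ = X * _]mxE [X in _ = _ * X]mxE.
by have [->|_] := eqVneq (pt j) 0; rewrite ?mul1r // mxE mul0r.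
Qed.

Lemma secant_cone v a : span_union (segre F n) 3 v -> a != 0 ->
  span_union (segre F n) 3 (a *: v).
Proof.
move=> [v0 [M [MX vM]]] a0; split; first by rewrite scaler_eq0 negb_or a0.
by exists M; split=> //; apply: scalemx_sub.
Qed.

(** [A] describes a curve through an arbitrary sum of three pure tensors and the
sum given by [b].  If its general points lie in the image of [psi], so does, up to
closure, each of its points: hence a density condition that has to be checked on
such curves only. *)
Lemma secant_chain_lt (T : finType) (psi : multi_index n -> {mpoly F[#|T|]})
    (b : 'I_3 -> 'I_k -> nat -> F) :
  (forall A : 'I_3 -> 'I_k -> nat -> {poly F},
     (forall j i l, (A j i l).[1] = b j i l) ->
     exists2 d : {poly F}, d != 0 & forall x, d.[x] != 0 ->
       exists t : T -> F, forall y : multi_index n,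
         coord3 (fun j i l => (A j i l).[x]) (fun i => y i)
           = (psi y).@[fun i => t (enum_val i)]) ->
  forall d, has_chain secant d -> (d < #|T|)%N.
Proof.
move=> gen d; pose Psi := [tuple psi (enum_val c) | c < N].
apply: (@chain_length_lt _ charF0 _ _ _ Psi) => [v a|p p0 v].
  exact: secant_cone.
move=> /span_unionP [v0 [a ->]].
(* the line that is a at 0 and b at 1 *)
pose A j i l := (a j i l)%:P * (1 - 'X) + (b j i l)%:P * 'X.
have [|e e0 eP] := gen A; first by move=> j i l; rewrite !hornerE subrr mulr0 add0r.
pose q := mmap (@polyC F)
  (fun c : 'I_N => coord3 A (fun i => (enum_val c : multi_index n) i)) p.
have qE x : q.[x] = p.@[fun c => coord3 (fun j i l => (A j i l).[x])
    (fun i => (enum_val c : multi_index n) i)].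
  rewrite /q mevalE /mmap horner_sum; apply: eq_bigr => m _.
  rewrite hornerCM /mmap1 horner_prod; congr (_ * _); apply: eq_bigr => c _.
  rewrite horner_exp; congr (_ ^+ _); rewrite horner_sum; apply: eq_bigr => j _.
  by rewrite horner_prod.
have q0 : q = 0.
  apply: (horner_eq0_cofinite charF0 e0) => x /eP [t tP].
  rewrite qE -[RHS](meval0 (fun i : 'I_#|T| => t (enum_val i))) -p0 comp_mpoly_meval.
  by apply: meval_eq => c; rewrite tP tnth_mktuple.
transitivity q.[0]; last by rewrite q0 horner0.
rewrite qE; apply: meval_eq => c; rewrite mxE; apply: eq_bigr => j _.
by apply: eq_bigr => i _; rewrite !hornerE; ring.
Qed.

Lemma secant_chain_lt_ambient d : has_chain secant d -> (d < N)%N.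
Proof.
apply: (@secant_chain_lt (multi_index n) (fun y => 'X_(enum_rank y)) (fun _ _ _ => 1)).
move=> A _; exists 1 => [|x _]; first exact: oner_neq0.
exists (fun y : multi_index n => coord3 (fun j i l => (A j i l).[x]) (fun i => y i)) => y.
by rewrite mevalXU enum_rankK.
Qed.

(** If the first coordinates of the factors are nonzero, they can be collected in one
scalar for each pure tensor; this leaves n_i coordinates in each factor. *)
Lemma secant_chain_lt_params d :
  has_chain secant d -> (d < 3 * (\sum_i n i) + 3)%N.
Proof.
pose T := ('I_3 * option {i : 'I_k & 'I_(n i)})%type.
have -> : (3 * (\sum_i n i) + 3 = #|{: T}|)%N.
  rewrite card_prod card_option card_ord card_tagged sumnE big_map big_enum /=.
  by rewrite -mulnSr; congr (_ * _.+1)%N;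
     apply: eq_bigr => i _; rewrite card_ord.
pose X (t : T) : {mpoly F[#|{: T}|]} := 'X_(enum_rank t).
apply: (@secant_chain_lt T (fun y => \sum_j X (j, None) * \prod_i
   (if unlift ord0 (y i) is Some l then X (j, Some (Tagged (fun i => 'I_(n i)) l))
    else 1)) (fun _ _ _ => 1)).
move=> A A1; exists (\prod_j \prod_i A j i 0%N) => [|x].
  apply: contraTneq (oner_neq0 F) => A0; rewrite negbK -(horner0 1) -A0.
  by rewrite horner_prod big1 // => j _; rewrite horner_prod big1.
rewrite horner_prod prodf_seq_neq0 => /allP A0.
have {}A0 j i : (A j i 0%N).[x] != 0.
  have := A0 j (mem_index_enum _); rewrite horner_prod prodf_seq_neq0 => /allP.
  by move/(_ i (mem_index_enum _)).
exists (fun t : T => if t.2 is Some s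
  then (A t.1 (tag s) (tagged s : 'I_(n (tag s))).+1).[x] / (A t.1 (tag s) 0%N).[x]
  else \prod_i (A t.1 i 0%N).[x]) => y.
rewrite /coord3 raddf_sum; apply: eq_bigr => j _ /=.
rewrite mevalM mevalXU enum_rankK rmorph_prod /= -big_split.
apply: eq_bigr => i _ /=; case: unliftP => [l|] ->.
  by rewrite mevalXU enum_rankK /= mulrC divfK.
by rewrite meval1 mulr1.
Qed.
End Segre.

(** * The exceptional cases *)

Lemma ord3P (i : 'I_3) : [\/ i = ord0, i = lift ord0 ord0
  | i = lift ord0 (lift ord0 ord0)].
Proof.
case: i => [[|[|[|//]]] ?];
by [constructor 1; apply: val_inj | constructor 2; apply: val_inj
   | constructor 3; apply: val_inj].
Qed.

Section Exceptions.
Variable F : fieldType.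
Hypothesis charF0 : [pchar F]%R =i pred0.

(** The tensor is a matrix with rows indexed by (y0, y1).  The rows (0,0), (1,0) and
(0,1) are parameters [inr]; the row (1,1) is a combination of them, with the three
parameters [inl] as coefficients, as soon as the matrix U of the rank one 2 x 2
tensors at these three positions is invertible. *)
Lemma secant_chain_lt_11a (n : 'I_3 -> nat) d :
  n ord0 = 1%N -> n (lift ord0 ord0) = 1%N ->
  has_chain (segre_secant F n 3) d -> (d < 3 * n (lift ord0 (lift ord0 ord0)) + 6)%N.
Proof.
set i1 : 'I_3 := lift ord0 ord0; set i2 : 'I_3 := lift ord0 (lift ord0 ord0).
move=> n0 n1; pose T := ('I_3 + 'I_3 * 'I_(n i2).+1)%type.
have -> : (3 * n i2 + 6 = #|{: T}|)%N by rewrite card_sum card_prod !card_ord; lia.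
pose X (t : T) : {mpoly F[#|{: T}|]} := 'X_(enum_rank t).
pose idx (v0 v1 : nat) : 'I_3 :=
  if v0 == 1%N then i1 else if v1 == 1%N then i2 else ord0.
(* e_0 (x) e_0, e_1 (x) e_0 and e_0 (x) e_1, for which U is the identity *)
pose b (j i : 'I_3) (l : nat) : F :=
  if i == ord0 then (l == (j == i1) :> nat)%:R
  else if i == i1 then (l == (j == i2) :> nat)%:R else 1.
apply: (@secant_chain_lt _ charF0 _ _ _ T (fun y =>
  if (y ord0 == 1%N :> nat) && (y i1 == 1%N :> nat)
  then \sum_q X (inl q) * X (inr (q, y i2))
  else X (inr (idx (y ord0) (y i1), y i2))) b) => // A A1.
pose U (R : comNzRingType) (a : 'I_3 -> 'I_3 -> nat -> R) : 'M[R]_3 :=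
  \matrix_(q, j) (a j ord0 (q == i1) * a j i1 (q == i2)).
have UE x : map_mx (horner_eval x) (U _ A) = U _ (fun j i l => (A j i l).[x]).
  by apply/matrixP => q j; rewrite !mxE /horner_eval hornerM.
exists (\det (U _ A)) => [|x].
  apply: contraTneq (oner_neq0 F) => A0; rewrite negbK -(horner0 1) -A0.
  rewrite -[_.[1]]/(horner_eval 1 _) -det_map_mx UE.
  suff -> : U _ (fun j i l => (A j i l).[1]) = 1%:M by rewrite det1.
  apply/matrixP => q j; rewrite !mxE !A1 /b /=.
  case: q => [[|[|[|//]]] ?]; case: j => [[|[|[|//]]] ?];
  by rewrite -?val_eqE /= ?mulr1 ?mulr0.
rewrite -[_.[x]]/(horner_eval x _) -det_map_mx UE.
set a := fun j i l => _; set M := U F a => M0.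
have Mu : M \in unitmx by rewrite unitmxE unitfE.
pose r := \row_j (a j ord0 1%N * a j i1 1%N).
exists (fun z : T => match z with
  | inl q => (r *m invmx M) 0 q
  | inr (q, l) => \sum_j M q j * a j i2 l end) => y.
have y0 : (y ord0 <= 1)%N by rewrite -ltnS (leq_trans (ltn_ord _)) // n0.
have y1 : (y i1 <= 1)%N by rewrite -ltnS (leq_trans (ltn_ord _)) // n1.
have e3 : coord3 a (fun i => y i)
    = \sum_j a j ord0 (y ord0) * a j i1 (y i1) * a j i2 (y i2).
  by apply: eq_bigr => j _; rewrite !big_ord_recl big_ord0 mulr1 mulrA.
rewrite e3; case: ifP => [/andP[/eqP -> /eqP ->]|y01].
  rewrite raddf_sum /=.
  under [RHS]eq_bigr => q _ do rewrite mevalM !mevalXU !enum_rankK mulr_sumr.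
  rewrite exchange_big; apply: eq_bigr => j _ /=.
  have := congr1 (fun v : 'rV_3 => v 0 j) (mulmxKV Mu r).
  rewrite !mxE => <-; rewrite mulr_suml; apply: eq_bigr => q _.
  by rewrite mulrA.
rewrite mevalXU enum_rankK; apply: eq_bigr => j _; rewrite mxE /idx.
by move: y01 y0 y1; case: (y ord0 : nat) => [|[|//]]; case: (y i1 : nat) => [|[|//]].
Qed.

Section ThreePoints.
Variable R : comNzRingType.
Implicit Types u w : 'I_3 -> nat -> R.
Let j0 : 'I_3 := ord0.
Let j1 : 'I_3 := lift ord0 ord0.
Let j2 : 'I_3 := lift ord0 (lift ord0 ord0).

Definition det2 (x y : nat -> R) : R := x 0%N * y 1%N - x 1%N * y 0%N.

(** The 2 x 2 matrix of a projectivity of P^1 that sends the three points u_j to the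
three points w_j: in the basis u_0, u_1 it is al * w_0, be * w_1, where al and be
are chosen by Cramer's rule so that the image of u_2 is a multiple of w_2. *)
Definition projmap u w (l z : nat) : R :=
  let al := det2 (w j2) (w j1) * det2 (u j0) (u j2) in
  let be := det2 (w j0) (w j2) * det2 (u j2) (u j1) in
  if z == 0%N then al * w j0 l * u j1 1%N - be * w j1 l * u j0 1%N
  else be * w j1 l * u j0 0%N - al * w j0 l * u j1 0%N.

(** The factor by which the image of u_j under [projmap] differs from w_j. *)
Definition projscale u w (j : 'I_3) : R :=
  if j == j0 then det2 (w j2) (w j1) * det2 (u j0) (u j2) * det2 (u j0) (u j1)
  else if j == j1 then det2 (w j0) (w j2) * det2 (u j2) (u j1) * det2 (u j0) (u j1)
  else det2 (u j0) (u j2) * det2 (u j2) (u j1) * det2 (w j0) (w j1).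

Lemma projmapE u w j l : (l <= 1)%N ->
  \sum_(z < 2) projmap u w l z * u j z = projscale u w j * w j l.
Proof.
move=> l1; rewrite !big_ord_recl big_ord0 /= /projmap /projscale /det2 /=.
have [] := ord3P j => ->; rewrite /bump /=;
case: l l1 => [|[|//]] _; ring.
Qed.
End ThreePoints.

(** In the notation of [projmap], g_p sends the points of the first factor to those
of the factor p + 1.  The tensor is the image of a symmetric one under
id (x) g_0 (x) g_1 (x) g_2.  The 5 parameters [inl] are the coefficients of the
symmetric tensor, a binary quartic, and the parameters [inr] are the entries of
the g_p, divided by the entry (0,0). *)
Lemma secant_chain_lt_1111 (n : 'I_4 -> nat) d :
  (forall i, n i = 1%N) ->
  has_chain (segre_secant F n 3) d -> (d < 14)%N.
Proof.
move=> n1; pose T := ('I_5 + 'I_3 * 'I_3)%type.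
have -> : 14%N = #|{: T}| by rewrite card_sum card_prod !card_ord.
pose X (t : T) : {mpoly F[#|{: T}|]} := 'X_(enum_rank t).
pose G (p : 'I_3) (l z : nat) : {mpoly F[#|{: T}|]} :=
  if (l == 0%N) && (z == 0%N) then 1 else X (inr (p, inord (l.*2 + z).-1)).
(* the points (1,0), (0,1) and (1,1) in all factors *)
pose b (j : 'I_3) (i : 'I_4) (l : nat) : F := ((j == l :> nat) || (j == 2 :> nat))%:R.
pose p0 : 'I_3 := ord0.
pose p1 : 'I_3 := lift ord0 ord0.
pose p2 : 'I_3 := lift ord0 (lift ord0 ord0).
apply: (@secant_chain_lt _ charF0 _ _ _ T (fun y =>
  \sum_(z0 < 2) \sum_(z1 < 2) \sum_(z2 < 2)
    X (inl (inord (y ord0 + z0 + z1 + z2)))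
    * G p0 (y (lift ord0 p0)) z0 * G p1 (y (lift ord0 p1)) z1
    * G p2 (y (lift ord0 p2)) z2) b) => // A A1.
pose g (R : comNzRingType) (a : 'I_3 -> 'I_4 -> nat -> R) (p : 'I_3) :=
  projmap (fun j => a j ord0) (fun j => a j (lift ord0 p)).
pose lam (R : comNzRingType) (a : 'I_3 -> 'I_4 -> nat -> R) (p : 'I_3) :=
  projscale (fun j => a j ord0) (fun j => a j (lift ord0 p)).
have gE x p l z : (g _ A p l z).[x] = g _ (fun j i l => (A j i l).[x]) p l z.
  by rewrite /g /projmap /det2; case: ifP => _; rewrite !hornerE.
have lamE x p j : (lam _ A p j).[x] = lam _ (fun j i l => (A j i l).[x]) p j.
  by rewrite /lam /projscale /det2; case: ifP => _; [|case: ifP => _]; rewrite !hornerE.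
exists (\prod_p (g _ A p 0%N 0%N * \prod_j lam _ A p j)) => [|x].
  apply: contraTneq (oner_neq0 F) => A0; rewrite negbK -(horner0 1) -A0.
  rewrite horner_prod big1 // => p _; rewrite hornerM gE horner_prod big1 => [|j _].
    by rewrite mulr1 /g /projmap /det2 /= !A1 /b /=; ring.
  rewrite lamE /lam /projscale /det2 !A1 /b /=; case: ifP => _; [|case: ifP => _]; ring.
rewrite horner_prod prodf_seq_neq0 => /allP A0.
set a := fun j i l => (A j i l).[x].
have g0 p : g _ a p 0%N 0%N != 0.
  have := A0 p (mem_index_enum _); rewrite /= hornerM mulf_eq0 negb_or gE.
  by case/andP.
have lam0 p j : lam _ a p j != 0.
  have := A0 p (mem_index_enum _); rewrite /= hornerM mulf_eq0 negb_or.
  case/andP=> _; rewrite horner_prod prodf_seq_neq0 => /allP/(_ j (mem_index_enum _)).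
  by rewrite /= lamE.
(* the weights that compensate the scaling factors of the normalized g_p *)
pose mu j := \prod_p (g _ a p 0%N 0%N / lam _ a p j).
pose t (z : T) : F := match z with
  | inl s => \sum_j mu j * a j ord0 0%N ^+ (4 - s) * a j ord0 1%N ^+ s
  | inr (p, m) => g _ a p (m.+1./2) (odd m.+1) / g _ a p 0%N 0%N
  end.
exists t => y.
have y1 i : (y i <= 1)%N by rewrite -ltnS (leq_trans (ltn_ord _)) // n1.
rewrite raddf_sum /=.
transitivity (\sum_(z0 < 2) \sum_(z1 < 2) \sum_(z2 < 2) \sum_j
  mu j * a j ord0 (y ord0) * a j ord0 z0 * a j ord0 z1 * a j ord0 z2
  * (g _ a p0 (y (lift ord0 p0)) z0 / g _ a p0 0%N 0%N)
  * (g _ a p1 (y (lift ord0 p1)) z1 / g _ a p1 0%N 0%N)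
  * (g _ a p2 (y (lift ord0 p2)) z2 / g _ a p2 0%N 0%N)).
  under eq_bigr => z0 _.
    under eq_bigr => z1 _ do rewrite exchange_big.
    rewrite exchange_big; over.
  rewrite exchange_big; apply: eq_bigr => j _ /=.
  have wE p : a j (lift ord0 p) (y (lift ord0 p)) =
      (g _ a p (y (lift ord0 p)) 0%N * a j ord0 0%N
       + g _ a p (y (lift ord0 p)) 1%N * a j ord0 1%N) / lam _ a p j.
    apply: (canRL (mulfK (lam0 p j))); rewrite mulrC -[LHS]projmapE //.
    by rewrite !big_ord_recl big_ord0 addr0.
  rewrite !big_ord_recl !big_ord0 !wE /mu !big_ord_recl big_ord0 /bump /=.
  rewrite -/p0 -/p1 -/p2; move: (g _ a) (lam _ a) g0 lam0 => gg ll g0 lam0.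
  by field; rewrite !g0 !lam0.
have GE p l z : (l <= 1)%N -> (z <= 1)%N ->
    (G p l z).@[fun i => t (enum_val i)] = g _ a p l z / g _ a p 0%N 0%N.
  rewrite /G; case: l z => [|[|//]] [|[|//]] _ _ /=; rewrite ?meval1 ?divff //;
  by rewrite mevalXU enum_rankK /t inordK.
apply: eq_bigr => z0 _; rewrite raddf_sum; apply: eq_bigr => z1 _.
rewrite raddf_sum; apply: eq_bigr => z2 _ /=.
have z_le (z : 'I_2) : (z <= 1)%N by rewrite -ltnS.
rewrite !mevalM !GE // mevalXU enum_rankK /t !mulr_suml.
apply: eq_bigr => j _; do 3![congr (_ * _)].
rewrite -!mulrA; congr (_ * _); rewrite inordK; last first.
  by move: (y1 ord0) (z_le z0) (z_le z1) (z_le z2); lia.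
move: (y1 ord0) (z_le z0) (z_le z1) (z_le z2).
case: (y ord0 : nat) => [|[|//]] _; case: (z0 : nat) => [|[|//]] _;
case: (z1 : nat) => [|[|//]] _; case: (z2 : nat) => [|[|//]] _ /=; ring.
Qed.
End Exceptions.

(** * Tangent spaces at three points *)

Lemma mderiv_prod (R : comNzRingType) m (I : eqType) (r : seq I) (f : I -> {mpoly R[m]}) l :
  uniq r -> (\prod_(i <- r) f i)^`M(l)
    = \sum_(i <- r) (f i)^`M(l) * \prod_(i' <- r | i' != i) f i'.
Proof.
elim: r => [|i r IH] /=; first by rewrite !big_nil -mpolyC1 mderivC.
case/andP=> ir /IH {}IH; rewrite !big_cons mderivM IH eqxx /=; congr (_ * _ + _).
  rewrite big_seq [RHS]big_seq_cond; apply: eq_bigl => i'.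
  by case: (boolP (i' \in r)) => // i'r; rewrite (memPn ir).
rewrite mulr_sumr; apply: eq_big_seq => i' i'r.
by rewrite big_cons eq_sym (memPn ir) // mulrCA.
Qed.

Section SegreLower.
Variable F : fieldType.
Hypothesis charF0 : [pchar F]%R =i pred0.
Variables (k : nat) (n : 'I_k -> nat).
Hypothesis k_gt0 : (0 < k)%N.

Local Notation N := #|{: multi_index n}|.
Local Notation secant := (segre_secant F n 3).

(** The direction [d] moves the factor [di d] of the pure tensor [dj d] along the
vector [ev d]; the hypothesis says that the point and these tangent vectors are
linearly independent. *)
Lemma secant_chain_of_tangents (D : finType) (W : 'I_3 -> 'I_k -> nat -> F)
    (dj : D -> 'I_3) (di : D -> 'I_k) (ev : D -> nat -> F) :
  (forall (a : F) (s : D -> F),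
    (forall v : 'I_k -> nat, (forall i, v i <= n i)%N ->
       a * coord3 W v + \sum_d s d * (ev d (v (di d))
         * \prod_(i | i != di d) W (dj d) i (v i)) = 0) ->
    a = 0 /\ forall d, s d = 0) ->
  has_chain secant #|D|.
Proof.
move=> indep.
pose e (l : 'I_#|D|) j i v := if (j == dj (enum_val l)) && (i == di (enum_val l))
  then ev (enum_val l) v else 0.
pose p j i v : {mpoly F[#|D|]} := (W j i v)%:MP + \sum_l e l j i v *: 'X_l.
pose Psi : N.-tuple {mpoly F[#|D|]} :=
  [tuple coord3 p (fun i => (enum_val c : multi_index n) i) | c < N].
have PsiE s c : (tnth Psi c).@[s] =
    coord3 (fun j i v => (p j i v).@[s]) (fun i => (enum_val c : multi_index n) i).
  rewrite tnth_mktuple raddf_sum; apply: eq_bigr => j _ /=.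
  by rewrite rmorph_prod.
have p0 j i v : (p j i v).@[fun=> 0] = W j i v.
  rewrite mevalD mevalC raddf_sum big1 ?addr0 // => l _ /=.
  by rewrite mevalZ mevalXU mulr0.
have dp l j i v x : ((p j i v)^`M(l)).@[x] = e l j i v.
  rewrite mderivD mderivC add0r (raddf_sum (mderiv l)) (raddf_sum (meval x)) /=.
  rewrite (bigD1 l) //= big1 => [|l' ll]; rewrite mderivZ mderivX mnm1E.
    rewrite eqxx scale1r (_ : (_ - _)%MM = 0%MM); last first.
      by apply/mnmP => i'; rewrite mnmBE subnn mnm0E.
    by rewrite mpolyX0 mevalZ meval1 mulr1 addr0.
  by rewrite (negbTE ll) scale0r scaler0 meval0.
apply: (@has_chain_of_immersion _ charF0 _ _ _ Psi) => [a s u u0|a s as0].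
  have ua : u = a *: tensor3 n (fun j i v => (p j i v).@[s]).
    by apply/rowP => c; rewrite !mxE PsiE.
  move: u0; rewrite ua scaler_eq0 negb_or => /andP[a0 t0].
  by apply: secant_cone => //; apply/span_unionP => //; split=> //; eexists.
have [|a0 s0] := indep a (fun d => s (enum_rank d)); last first.
  by split=> // l; have := s0 (enum_val l); rewrite enum_valK.
move=> v vn; pose y : multi_index n := finfun (fun i => inord (v i)).
have yE i : y i = v i :> nat by rewrite ffunE inordK // ltnS.
rewrite -[RHS](as0 (enum_rank y)); congr (_ * _ + _).
  rewrite PsiE; apply: eq_bigr => j _; apply: eq_bigr => i _.
  by rewrite p0 enum_rankK yE.
rewrite (reindex (@enum_val D D)) /=; last first.
  by exists enum_rank => x _; rewrite ?enum_valK ?enum_rankK.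
apply: eq_bigr => l _; rewrite enum_valK; congr (_ * _).
rewrite tnth_mktuple enum_rankK (raddf_sum (mderiv l)) (raddf_sum (meval _)) /=.
rewrite (bigD1 (dj (enum_val l))) //= [X in _ + X]big1 ?addr0 => [|j /negbTE jl].
  rewrite mderiv_prod ?index_enum_uniq // (raddf_sum (meval _)) /=.
  rewrite [RHS](bigD1 (di (enum_val l))) //= [X in _ + X]big1 ?addr0 => [|i /negbTE il].
    rewrite mevalM dp /e !eqxx yE (rmorph_prod (meval _)) /=; congr (_ * _).
    by apply: eq_bigr => i _ /=; rewrite p0 yE.
  by rewrite mevalM dp /e il andbF mul0r.
rewrite mderiv_prod ?index_enum_uniq // (raddf_sum (meval _)) big1 // => i _ /=.
by rewrite mevalM dp /e jl mul0r.
Qed.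

(** The coordinates v of a tensor in which the tangent spaces at e_0 (x) ... (x) e_0
and e_1 (x) ... (x) e_1 vanish; the booleans stand for 0 and 1. *)
Definition far (v : 'I_k -> nat) :=
  forall b : bool, (1 < #|[set i | v i != b]|)%N.

Hypothesis k_gt2 : (2 < k)%N.
Hypothesis n_gt0 : forall i, (0 < n i)%N.

Let i0 : 'I_k := Ordinal k_gt0.
Let j0 : 'I_3 := ord0.
Let j1 : 'I_3 := lift ord0 ord0.
Let j2 : 'I_3 := lift ord0 (lift ord0 ord0).

Lemma prod_indic_far (b : bool) (v : 'I_k -> nat) :
  (1 < #|[set i | v i != b]|)%N ->
  \prod_i (v i == b)%:R = 0 :> F
  /\ forall i, \prod_(i' | i' != i) (v i' == b)%:R = 0 :> F.
Proof.
move=> vb; have key i : \prod_(i' | i' != i) (v i' == b)%:R = 0 :> F.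
  have [i' i'b i'i] : exists2 i', v i' != b & i' != i.
    have : (0 < #|[set i | v i != b] :\ i|)%N.
      by move: vb; rewrite (cardsD1 i); case: (_ \in _) => //; case: #|_|.
    by case/card_gt0P => i'; rewrite !inE => /andP[? ?]; exists i'.
  by rewrite (bigD1 i') //= (negbTE i'b) mul0r.
by split=> //; rewrite (bigD1 i0) //= key mulr0.
Qed.

Lemma card_others (v : 'I_k -> nat) (b : bool) i :
  (forall i', i' != i -> v i' = b) -> (1 < #|[set i | v i != ~~ b]|)%N.
Proof.
move=> vb; apply: leq_trans (_ : #|[set~ i]| <= _)%N.
  by rewrite cardsC1 card_ord; lia.
by apply/subset_leq_card/subsetP => i'; rewrite !inE => /vb ->; case: (b).
Qed.

(** The directions at the first two points are all e_l with l <> b in all factors,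
together with the scaling of the second point.  The scaling of the first point is
left out, since the point itself already counts as a direction.  So it remains to
choose the third point [W2] and directions [E] there.  Far coordinates only see
the third point; once its contribution g is known to vanish, the coordinates that
differ from 0...0 or 1...1 in at most one place give the coefficients at the first
two points one by one. *)
Lemma secant_chain_of_third_point (E : finType) (W2 : 'I_k -> nat -> F)
    (ei : E -> 'I_k) (ev : E -> nat -> F) :
  (forall (a : F) (s : E -> F),
    let g v := a * (\prod_i W2 i (v i)) + \sum_e s e * (ev e (v (ei e))
                 * \prod_(i | i != ei e) W2 i (v i)) in
    (forall v, (forall i, v i <= n i)%N -> far v -> g v = 0) ->
    a + g (fun=> 0%N) = 0 -> a = 0 /\ forall e, s e = 0) ->
  has_chain secant (2 * (\sum_i n i) + 1 + #|E|).
Proof.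
move=> third; pose S := {i : 'I_k & 'I_(n i)}.
pose D := ((bool * S + unit) + E)%type.
have -> : (2 * (\sum_i n i) + 1 + #|E| = #|{: D}|)%N.
  rewrite !card_sum card_prod card_bool card_unit card_tagged sumnE big_map.
  rewrite big_enum /=; congr (2 * _ + _ + _)%N.
  by apply: eq_bigr => i _; rewrite card_ord.
pose W (j : 'I_3) i (l : nat) : F :=
  if j == j0 then (l == false)%:R else if j == j1 then (l == true)%:R else W2 i l.
apply: (@secant_chain_of_tangents D W
  (fun d => match d with inl (inl (b, _)) => if b then j1 else j0
            | inl (inr _) => j1 | inr _ => j2 end)
  (fun d => match d with inl (inl (_, x)) => tag x
            | inl (inr _) => i0 | inr e => ei e end)
  (fun d l => match d with inl (inl (b, x)) => (l == bump b (tagged x : 'I_(n (tag x))))%:R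
            | inl (inr _) => (l == true)%:R | inr e => ev e l end)).
move=> a s H.
pose g v := a * (\prod_i W2 i (v i)) + \sum_e s (inr e) * (ev e (v (ei e))
                 * \prod_(i | i != ei e) W2 i (v i)).
pose ga (b : bool) := if b then a + s (inl (inr tt)) else a.
pose f (b : bool) (v : 'I_k -> nat) : F := ga b * (\prod_i (v i == b)%:R)
  + \sum_(x : S) s (inl (inl (b, x))) * ((v (tag x) == bump b (tagged x : 'I_(n (tag x))))%:R
     * \prod_(i | i != tag x) (v i == b)%:R).
have {}H v : (forall i, v i <= n i)%N -> f false v + f true v + g v = 0.
  move=> /H <-; rewrite /coord3 !big_ord_recl big_ord0 !big_sumType /=.
  rewrite (eq_bigr (fun p : bool * S => s (inl (inl (p.1, p.2))) *
    ((v (tag p.2) == bump p.1 (tagged p.2 : 'I_(n (tag p.2))))%:R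
     * \prod_(i | i != tag p.2) (v i == p.1)%:R))); last by case=> [[] x] _.
  rewrite -(pair_bigA _ (fun b x => s (inl (inl (b, x))) *
    ((v (tag x) == bump b (tagged x : 'I_(n (tag x))))%:R
     * \prod_(i | i != tag x) (v i == b)%:R))) /=.
  rewrite big_bool /f /g /= /W /=.
  have -> : \sum_(u : unit) s (inl (inr u))
      * ((v i0 == 1)%:R * \prod_(i | i != i0) (v i == 1)%:R)
    = s (inl (inr tt)) * \prod_i (v i == 1)%:R.
    rewrite (bigD1 tt) //= [X in _ + X]big1 => [|[] //]; rewrite addr0; congr (_ * _).
    by rewrite [RHS](bigD1 i0).
  set A := \prod_i _; set B := \prod_i _; set C := \prod_i _.
  rewrite !mulrDr; ring.
have f_far (b : bool) (v : 'I_k -> nat) : (1 < #|[set i | v i != b]|)%N -> f b v = 0.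
  move=> /prod_indic_far [p1 p2]; rewrite /f p1 mulr0 add0r big1 // => x _.
  by rewrite p2 !mulr0.
have f_const (b : bool) : f b (fun=> b : nat) = ga b.
  rewrite /f big1 => [|i _]; last by rewrite eqxx.
  rewrite mulr1 big1 ?addr0 // => x _.
  by rewrite (negbTE (neq_bump _ _)) mul0r mulr0.
have const_le (b : bool) i : ((b : nat) <= n i)%N.
  by apply: leq_trans (n_gt0 i); case: b.
have [||a0 s0] := third a (fun e => s (inr e)).
- move=> v vn vfar; have := H v vn; rewrite !f_far ?add0r //; exact: vfar.
- have := H (fun=> false : nat) (const_le false); rewrite (f_const false).
  by rewrite f_far ?addr0 // (@card_others _ false i0).
have {}H v : (forall i, v i <= n i)%N -> f false v + f true v = 0.
  move=> /H <-; rewrite /g a0 mul0r add0r big1 ?addr0 // => e _.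
  by rewrite s0 mul0r.
have other (b : bool) (v : 'I_k -> nat) i :
    (forall i, v i <= n i)%N -> (forall i', i' != i -> v i' = b) -> f b v = 0.
  move=> /H vn /card_others /f_far vb.
  by case: b vb vn => /= ->; rewrite ?addr0 ?add0r.
have ga0 b : ga b = 0 by rewrite -f_const (other b _ i0).
have sx b x : s (inl (inl (b, x))) = 0.
  pose v i := if i == tag x then bump b (tagged x : 'I_(n (tag x))) else b : nat.
  rewrite -(other b v (tag x)); last 2 first.
  - move=> i; rewrite /v; case: eqP => [->|_ //].
    by rewrite /bump; have := ltn_ord (tagged x : 'I_(n (tag x))); lia.
  - by move=> i /negbTE ix; rewrite /v ix.
  rewrite /f ga0 mul0r add0r (bigD1 x) //= /v eqxx eqxx mul1r.
  rewrite big1 => [|i /negbTE ->]; last by rewrite eqxx.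
  rewrite mulr1 big1 ?addr0 // => x' xx'.
  have [xi|xi] := eqVneq (tag x') (tag x); last first.
    by rewrite (negbTE (neq_bump _ _)) mul0r mulr0.
  case: eqP => [e|_]; last by rewrite mul0r mulr0.
  case/eqP: xx'; case: x x' xi {v} e => [i l] [i' l'] /= ii; move: l'; rewrite ii => l'.
  by move/(can_inj (@bumpK b))/val_inj->.
split=> // -[[[b x]|[]]|e] //.
by have := ga0 true; rewrite /ga a0 add0r.
Qed.
End SegreLower.

(** * Independence of the tangent spaces *)

Lemma ex_subset_card (T : finType) (A : {set T}) m : (m <= #|A|)%N ->
  exists2 B : {set T}, B \subset A & #|B| = m.
Proof.
elim: m => [|m IH] mA; first by exists set0; rewrite ?sub0set ?cards0.
have [B BA Bm] := IH (ltnW mA).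
have /card_gt0P [x] : (0 < #|A :\: B|)%N by rewrite cardsDS // Bm subn_gt0.
rewrite inE => /andP[xB xA]; exists (x |: B); last by rewrite cardsU1 xB Bm.
by rewrite subUset sub1set xA.
Qed.

Lemma tagged_ord_inj (I : Type) (n : I -> nat) (x x' : {i : I & 'I_(n i)}) :
  tag x' = tag x ->
  (tagged x : 'I_(n (tag x))) = (tagged x' : 'I_(n (tag x'))) :> nat -> x' = x.
Proof.
case: x x' => [i l] [i' l'] /= ii; subst i' => ll.
by congr existT; apply: val_inj.
Qed.

Section Nondefective.
Variable F : fieldType.
Hypothesis charF0 : [pchar F]%R =i pred0.

(** Let O be the set of factors of dimension 2 and E its complement.  At the
multi-index with value 2 on E, 1 on Z and 0 on O \ Z, the third tangent vector has
the coordinate ga + (sum of the coefficients at Z); it has #|E| + #|Z| values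
other than 0 and k - #|Z| values other than 1.  Taking #|Z| = 2 - #|E| and adding
one element to Z isolates a coefficient at O; this needs #|O| + 2 #|E| >= 5.  A
coefficient at i in E is read off by changing the value at i as well. *)
Lemma secant_chain_nonfilling (k : nat) (n : 'I_k -> nat) :
  (2 < k)%N -> (forall i, 0 < n i)%N ->
  (5 <= \sum_i (if n i == 1%N then 1 else 2))%N ->
  has_chain (segre_secant F n 3) (3 * (\sum_i n i) + 2).
Proof.
move=> k3 n0 n5; have k0 : (0 < k)%N by lia.
pose i0 : 'I_k := Ordinal k0; pose S := {i : 'I_k & 'I_(n i)}.
pose W i (l : nat) : F := if n i == 1%N then 1 else (l == 2%N)%:R.
pose O := [set i | n i == 1%N].
have OE : (5 <= #|O| + 2 * #|~: O|)%N.
  rewrite -!sum1_card [(2 * _)%N]big_distrr /=.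
  move: n5; rewrite (bigID (mem O)) /=; congr (_ <= _ + _)%N.
    by apply: eq_bigr => i; rewrite inE => ->.
  by apply: eq_big => i; rewrite ?inE // => /negbTE ->.
have OEk : (#|O| + #|~: O| = k)%N by rewrite cardsC card_ord.
have -> : (3 * (\sum_i n i) + 2 = 2 * (\sum_i n i) + 1 + #|{: option S}|)%N.
  have -> : #|{: option S}| = (\sum_i n i).+1.
    rewrite card_option card_tagged sumnE big_map big_enum /=; congr _.+1.
    by apply: eq_bigr => i _; rewrite card_ord.
  by lia.
apply: (@secant_chain_of_third_point _ charF0 _ _ k0 k3 n0 _ W
  (* None is the scaling of the third point: it moves factor i0 along itself. *)
  (fun x => if x is Some x then tag x else i0)
  (fun x l => if x is Some x
     then (l == bump (if n (tag x) == 1%N then 0 else 2) (tagged x : 'I_(n (tag x))))%:R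
     else W i0 l)).
move=> a s g g0 ag.
pose ga := a + s None.
have gE v : g v = ga * (\prod_i W i (v i)) + \sum_(x : S) s (Some x) *
   ((v (tag x) == bump (if n (tag x) == 1%N then 0 else 2) (tagged x : 'I_(n (tag x))))%:R
     * \prod_(i | i != tag x) W i (v i)).
  have PW : W i0 (v i0) * \prod_(i | i != i0) W i (v i) = \prod_i W i (v i).
    by rewrite [RHS](bigD1 i0).
  rewrite /g (bigD1 None) //= PW addrA -mulrDl; congr (_ + _).
  rewrite (reindex_omap Some id) /=; last by case.
  by apply: eq_bigl => x; rewrite eqxx.
have cardEZ (Z : {set 'I_k}) : Z \subset O -> #|~: O :|: Z| = (#|~: O| + #|Z|)%N.
  move=> ZO; rewrite cardsU (_ : ~: O :&: Z = set0) ?cards0 ?subn0 //.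
  by apply/eqP; rewrite -subset0 -(setICr O) setIC setSI.
pose pt (Z : {set 'I_k}) i : nat := if i \in O then (i \in Z) : nat else 2.
have Wpt Z i : W i (pt Z i) = 1.
  by rewrite /W /pt inE; case: ifP => // ->.
have tag0 (y : S) : n (tag y) = 1%N -> (tagged y : 'I_(n (tag y))) = 0%N :> nat.
  by move=> e; apply/eqP; rewrite -leqn0 -ltnS (leq_trans (ltn_ord _)) ?e.
have ptZ (Z : {set 'I_k}) : Z \subset O -> (1 < #|~: O| + #|Z|)%N -> (#|Z| + 1 < k)%N ->
    ga + \sum_(x : S | tag x \in Z) s (Some x) = 0.
  move=> ZO Z1 Z2; rewrite -[RHS](g0 (pt Z)).
  - rewrite gE [X in _ = _ * X + _]big1 ?mulr1 => [|i _]; last exact: Wpt.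
    congr (_ + _); rewrite big_mkcond; apply: eq_bigr => x _ /=.
    rewrite big1 // mulr1 /pt inE.
    have [n1|n1] := eqVneq (n (tag x)) 1%N.
      by rewrite tag0 //; case: ifP => _ /=; rewrite ?mulr1 ?mulr0.
    rewrite (negbTE (neq_bump _ _)) mulr0; case: ifP => // /(subsetP ZO).
    by rewrite inE (negbTE n1).
  - move=> i; have := n0 i; rewrite /pt inE; case: eqP => [->|]; last by lia.
    by case: (_ \in _).
  case.
    apply: leq_trans (_ : #|~: Z| <= _)%N.
      by rewrite cardsCs setCK card_ord; lia.
    apply/subset_leq_card/subsetP => i; rewrite !inE /pt inE => /negbTE ->.
    by case: ifP.
  apply: leq_trans (_ : #|~: O :|: Z| <= _)%N; first by rewrite cardEZ.
  apply/subset_leq_card/subsetP => i; rewrite !inE /pt inE.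
  by case: (n i == 1%N) => //= ->.
have sO x : tag x \in O -> s (Some x) = 0.
  move=> xO; have [|Z ZO Zh] := @ex_subset_card _ (O :\ tag x) (2 - #|~: O|).
    by have := cardsD1 (tag x) O; rewrite xO; lia.
  have ZO' : Z \subset O := subset_trans ZO (subsetDl _ _).
  have xZ : tag x \notin Z.
    by apply/negP => /(subsetP ZO); rewrite !inE eqxx.
  have Z1 := @ptZ Z ZO'; have Z2 := @ptZ (tag x |: Z).
  have O1 : (0 < #|O|)%N by apply/card_gt0P; exists (tag x).
  move: Z1 Z2; rewrite cardsU1 xZ Zh subUset sub1set xO ZO'.
  move=> Z1 /(_ isT) Z2.
  have {}Z1 : ga + \sum_(x : S | tag x \in Z) s (Some x) = 0 by apply: Z1; lia.
  have {}Z2 : ga + \sum_(x0 : S | tag x0 \in tag x |: Z) s (Some x0) = 0 by apply: Z2; lia.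
  move: Z2; rewrite (bigD1 x) ?inE ?eqxx //= addrCA.
  rewrite (eq_bigl (fun x' => tag x' \in Z)) ?Z1 ?addr0 // => x'.
  rewrite !inE; have [xx|xx] := eqVneq (tag x') (tag x); last first.
    have -> : x' != x by apply: contraNneq xx => ->.
    by rewrite andbT.
  rewrite /= xx (negbTE xZ); apply/negbTE; rewrite negbK; apply/eqP.
  move: xO; rewrite inE => /eqP; move=> n1; apply: tagged_ord_inj => //.
  have n1' : n (tag x') = 1%N by rewrite xx.
  by rewrite !tag0.
have ga0 : ga = 0.
  have [|Z ZO Zh] := @ex_subset_card _ O (2 - #|~: O|); first by lia.
  have := @ptZ Z ZO; rewrite Zh big1 ?addr0 => [|x /(subsetP ZO)]; last exact: sO.
  by apply; lia.
have sE x : tag x \notin O -> s (Some x) = 0.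
  move=> xO; set i := tag x; set l := bump 2 (tagged x : 'I_(n (tag x))).
  have E1 : (0 < #|~: O|)%N by apply/card_gt0P; exists (tag x); rewrite inE.
  have [|Z ZO Zh] := @ex_subset_card _ O ((l == 0%N) + 2 - #|~: O|).
    by case: (l == 0%N); lia.
  have iZ : i \notin Z by apply: contra xO; apply: (subsetP ZO).
  have n1 : n i != 1%N by move: xO; rewrite inE.
  pose v i' := if i' == i then l else pt Z i'.
  have vi i' : i' != i -> W i' (v i') = 1 by rewrite /v => /negbTE ->.
  have Wi : W i (v i) = 0.
    by rewrite /v eqxx /W (negbTE n1) eq_sym (negbTE (neq_bump _ _)).
  rewrite -[RHS](g0 v).
  - rewrite gE ga0 mul0r add0r (bigD1 x) //= [X in _ = _ + X]big1 ?addr0 => [|x' xx].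
      by rewrite (negbTE n1) big1 // /v !eqxx !mulr1.
    have [xi|xi] := eqVneq (tag x') i; last first.
      by rewrite (bigD1 i) 1?eq_sym //= Wi mul0r !mulr0.
    case: eqP => [e|_]; last by rewrite mul0r mulr0.
    have nx' : n (tag x') != 1%N by rewrite xi.
    move: e; rewrite (negbTE nx') /v (introT eqP xi) => /(can_inj (@bumpK 2)) e.
    by case/eqP: xx; apply: tagged_ord_inj.
  - move=> i'; rewrite /v; case: eqP => [->|_].
      have := ltn_ord (tagged x : 'I_(n (tag x))).
      by rewrite /l /bump /i; move: n1 (n0 i); rewrite /i; lia.
    have := n0 i'; rewrite /pt inE; case: eqP => [->|]; last by lia.
    by case: (_ \in _).
  have card0 := cardEZ Z ZO.
  case.
    have [l1|l1] := eqVneq l 1%N.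
      apply: leq_trans (_ : #|~: (i |: Z)| <= _)%N.
        by rewrite cardsCs setCK card_ord cardsU1 iZ; move: Zh; rewrite l1; lia.
      apply/subset_leq_card/subsetP => i'; rewrite !inE /v negb_or => /andP[/negbTE ->].
      by rewrite /pt => /negbTE ->; case: ifP.
    apply: leq_trans (_ : #|~: Z| <= _)%N.
      by rewrite cardsCs setCK card_ord; move: Zh; case: (l == 0%N); lia.
    apply/subset_leq_card/subsetP => i'; rewrite !inE /v /pt => /negbTE ->.
    by case: (i' == i); [exact: l1 | case: ifP].
  have [l1|l1] := eqVneq l 0%N.
    apply: leq_trans (_ : #|(~: O :|: Z) :\ i| <= _)%N.
      have := cardsD1 i (~: O :|: Z); rewrite !inE n1 card0 Zh l1 /=; lia.
    apply/subset_leq_card/subsetP => i'; rewrite !inE /v /pt => /andP[/negbTE ->].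
    by rewrite inE; case: (n i' == 1%N) => //= ->.
  apply: leq_trans (_ : #|~: O :|: Z| <= _)%N.
    by rewrite card0 Zh (negbTE l1); lia.
  apply/subset_leq_card/subsetP => i'; rewrite !inE /v /pt.
  by case: (i' == i); [rewrite l1 | rewrite inE; case: (n i' == 1%N) => //= ->].
have s0 x : s (Some x) = 0 by have [/sO|/sE] := boolP (tag x \in O).
have a0 : a = 0.
  by move: ag; rewrite gE ga0 mul0r add0r big1 ?addr0 // => x _; rewrite s0 mul0r.
by split=> // -[x|//]; move: ga0; rewrite /ga a0 add0r.
Qed.

(** Two points fill the space, so the third one is taken to be zero. *)
Lemma secant_chain_111 (n : 'I_3 -> nat) : (forall i, n i = 1%N) ->
  has_chain (segre_secant F n 3) 7.
Proof.
move=> n1; have -> : 7%N = (2 * (\sum_i n i) + 1 + #|{: void}|)%N.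
  by rewrite !big_ord_recl big_ord0 !n1 card_void.
apply: (@secant_chain_of_third_point _ charF0 3 n isT isT _ void (fun _ _ => 0)
  (fun=> ord0) (fun _ _ => 0)) => [i|a s g _]; first by rewrite n1.
rewrite /g big_ord_recl !mul0r mulr0 add0r big1 => [|[]]; rewrite addr0 => ->.
by split=> // -[].
Qed.

(** At w = (e_0 + e_1) (x) (e_0 + e_1) (x) e_2 only the directions e_1 in the first two
factors are kept: 11 directions and the point span the space of dimension 12. *)
Lemma secant_chain_112 (n : 'I_3 -> nat) :
  n ord0 = 1%N -> n (lift ord0 ord0) = 1%N -> n (lift ord0 (lift ord0 ord0)) = 2%N ->
  has_chain (segre_secant F n 3) 11.
Proof.
set i1 : 'I_3 := lift ord0 ord0; set i2 : 'I_3 := lift ord0 (lift ord0 ord0).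
move=> n0 n1 n2.
have -> : 11%N = (2 * (\sum_i n i) + 1 + #|{: bool}|)%N.
  by rewrite !big_ord_recl big_ord0 n0 n1 n2 card_bool.
apply: (@secant_chain_of_third_point _ charF0 3 n isT isT _ bool
  (fun i l => if i == i2 then (l == 2%N)%:R else 1)
  (fun b => if b then i1 else ord0) (fun _ l => (l == 1%N)%:R)) => [i|a s g g0 ag].
  by have [] := ord3P i => ->; rewrite ?n0 ?n1 ?n2.
have gE v : g v = (v i2 == 2%N)%:R *
    (a + s false * (v ord0 == 1%N)%:R + s true * (v i1 == 1%N)%:R).
  rewrite /g big_bool /= !(big_mkcond (fun i => i != _)) !big_ord_recl !big_ord0 /=.
  by ring.
pose v3 x y z (i : 'I_3) : nat := if i == ord0 then x else if i == i1 then y else z.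
have v3_le x y z : (x <= 1)%N -> (y <= 1)%N -> (z <= 2)%N -> forall i, (v3 x y z i <= n i)%N.
  move=> x1 y1 z1 i.
  by have [] := ord3P i => ->; rewrite ?n0 ?n1 ?n2.
have v3_far x y : (x + y = 1)%N -> far (v3 x y 2%N).
  move=> xy b; rewrite -sum1_card big_mkcond !big_ord_recl big_ord0 !inE /v3 /=.
  by case: x y xy b => [|[|//]] [|[|//]] // _ [].
have e1 : a + s false = 0.
  rewrite -[RHS](g0 (v3 1%N 0%N 2%N)); [|exact: v3_le|exact: v3_far].
  by rewrite gE /v3 /= mul1r mulr1 mulr0 addr0.
have e2 : a + s true = 0.
  rewrite -[RHS](g0 (v3 0%N 1%N 2%N)); [|exact: v3_le|exact: v3_far].
  by rewrite gE /v3 /= mul1r mulr1 mulr0 addr0.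
have a0 : a = 0 by move: ag; rewrite gE mul0r addr0.
by split=> // -[]; [move: e2 | move: e1]; rewrite a0 add0r.
Qed.

Lemma secant_chain_0 (k : nat) (n : 'I_k -> nat) : (0 < k)%N ->
  has_chain (segre_secant F n 3) 0.
Proof.
move=> k0; rewrite -[X in has_chain _ X]card_void.
apply: (@secant_chain_of_tangents _ charF0 k n k0 void (fun _ _ _ => 1)
  (fun=> ord0) (fun=> Ordinal k0) (fun _ _ => 0)) => a s /(_ (fun=> 0%N) (fun=> isT)).
have -> : coord3 (fun _ _ _ => 1) (fun _ : 'I_k => 0%N) = 3%:R :> F.
  transitivity (\sum_(j < 3) (1 : F)); first by apply: eq_bigr => j _; apply: big1.
  by rewrite sumr_const card_ord.
rewrite [X in _ + X]big1 => [|[]]; rewrite addr0 => /eqP.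
rewrite mulf_eq0 ((pcharf0P F).1 charF0) orbF => /eqP ->.
by split=> // -[].
Qed.

(** * The theorem *)

Lemma has_dim_exists N (Z : 'rV[F]_N -> Prop) b :
  has_chain Z 0 -> (forall d, has_chain Z d -> (d < b)%N) ->
  exists2 d, has_dim Z d & (d < b)%N.
Proof.
move=> Z0; elim: b => [|b IH] Zb; first by have := Zb _ Z0.
have [Zc|nZc] := classic (has_chain Z b).
  by exists b => //; split=> // d /Zb.
have [|d dd db] := IH; last by exists d => //; apply: ltnW.
move=> d Zd; have := Zb _ Zd; rewrite ltnS leq_eqVlt => /orP[/eqP db|//].
by case: nZc; rewrite -db.
Qed.

Lemma card_multi_index k (n : 'I_k -> nat) :
  #|{: multi_index n}| = (\prod_i (n i).+1)%N.
Proof.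
rewrite card_dep_ffun foldrE big_map big_enum /=.
by apply: eq_bigr => i _; rewrite card_ord.
Qed.
End Nondefective.

Local Close Scope ring_scope.

Theorem theorem4p5 (F : fieldType) (charF0 : [pchar F]%R =i pred0)
    (k : nat) (n : k.-tuple nat) (k_ge3 : 3 <= k) (n_sorted : path leq 1 n) :
  let exceptional :=
    (exists2 a, 3 <= a & n = [:: 1; 1; a] :> seq nat)
      \/ n = [:: 1; 1; 1; 1] :> seq nat in
  (~ exceptional -> nondefective F (tnth n) 3)
    /\ (exceptional -> defective F (tnth n) 3).
Proof.
move=> exceptional.
have n_gt0 i : (0 < tnth n i)%N.
  have : all (leq 1) n by apply: order_path_min n_sorted; apply: leq_trans.
  by move/allP; apply; apply: mem_tnth.
have k0 : (0 < k)%N by lia.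
set sn := (\sum_i tnth n i)%N; set pn := (\prod_i (tnth n i).+1)%N.
have upN d : has_chain (segre_secant F (tnth n) 3) d -> (d <= pn - 1)%N.
  by move/(secant_chain_lt_ambient charF0 k0); rewrite card_multi_index -/pn; lia.
have up3 d : has_chain (segre_secant F (tnth n) 3) d -> (d <= 3 * sn + 3 - 1)%N.
  by move/(secant_chain_lt_params charF0 k0); rewrite -/sn; lia.
have full d : has_chain (segre_secant F (tnth n) 3) d ->
    ((pn - 1 <= d) || (3 * sn + 3 - 1 <= d))%N -> nondefective F (tnth n) 3.
  move=> dc dge; have dE : d = expected_dim (tnth n) 3.
    by rewrite /expected_dim -/sn -/pn; move: (upN _ dc) (up3 _ dc) dge; lia.
  rewrite /nondefective -dE; split=> // e ec; move: (upN _ ec) (up3 _ ec) dge; lia.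
have sumE (G : nat -> nat) : (\sum_i G (tnth n i) = \sum_(x <- n) G x)%N.
  by rewrite big_tuple.
have prodE (G : nat -> nat) : (\prod_i G (tnth n i) = \prod_(x <- n) G x)%N.
  by rewrite big_tuple.
have snE := sumE id; have pnE := prodE S; rewrite /= -/sn -/pn in snE pnE.
have sz := size_tuple n.
split=> [nexc|].
  have [big|] := leqP 5 (\sum_i (if tnth n i == 1 then 1 else 2)).
    by apply: full (secant_chain_nonfilling charF0 k_ge3 n_gt0 big) _; rewrite -/sn; lia.
  rewrite (sumE (fun x => if x == 1 then 1 else 2)).
  have c12 x : (if x == 1 then 1 else 2) = 1 + (x != 1) by case: eqP.
  move: n_sorted nexc snE pnE sz; rewrite /exceptional.
  case ns: (tval n) => [|x [|y [|z [|t s]]]];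
    rewrite ?big_cons ?big_nil ?c12 /=; try by lia.
  - move=> le nexc snE pnE k3 small; subst k.
    have tnE i : tnth n i = nth 0 [:: x; y; z] i by rewrite (tnth_nth 0) ns.
    have z_lt3 : z < 3.
      rewrite ltnNge; apply/negP => z3; case: nexc; left; exists z => //.
      by congr [:: _; _; _]; move: small le; lia.
    have [x1 y1] : x = 1 /\ y = 1.
      by split; move: small le; lia.
    move: tnE snE pnE; rewrite {}x1 {}y1 => tnE snE pnE.
    case: z z_lt3 {ns le nexc small} tnE snE pnE => [|[|[|//]]] _ tnE snE pnE.
    + by have := n_gt0 ord_max; rewrite tnE.
    + apply: full (secant_chain_111 charF0 _) _; last by rewrite pnE.
      by move=> i; have [] := ord3P i => ->; rewrite tnE.
    + by apply: full (secant_chain_112 charF0 _ _ _) _; rewrite ?tnE // pnE.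
  move=> le nexc _ _ _ small; case: nexc; right.
  have s0 : s = [::].
    by case: s small le {ns} => // u s; rewrite big_cons c12; lia.
  rewrite {}s0 big_nil in small *.
  by congr [:: _; _; _; _]; move: small le; lia.
move=> exc; apply: has_dim_exists; first exact: secant_chain_0.
move=> d dc; case: exc => [[a a3 ns]|ns].
  move: sz snE pnE; rewrite ns !big_cons !big_nil /= => k3 snE pnE; subst k.
  have tnE i : tnth n i = nth 0 [:: 1; 1; a] i by rewrite (tnth_nth 0) ns.
  have := secant_chain_lt_11a charF0 _ _ dc; rewrite !tnE /= => /(_ erefl erefl).
  by rewrite /expected_dim -/sn -/pn; lia.
move: sz snE pnE; rewrite ns !big_cons !big_nil /= => k4 snE pnE; subst k.
have tnE i : tnth n i = nth 0 [:: 1; 1; 1; 1] i by rewrite (tnth_nth 0) ns.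
have := secant_chain_lt_1111 charF0 _ dc; rewrite /expected_dim -/sn -/pn snE pnE.
by apply => i; rewrite tnE; case: i => [[|[|[|[|]]]]].
Qed.
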